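(* Let $\phi:M\to N$ be a homomorphism of modules over a real polyhedral group $Q$, with coefficients in a field $k$. (1) If $\phi$ is injective, then $\mathrm{soc}_\tau\phi:\mathrm{soc}_\tau M\to\mathrm{soc}_\tau N$ is injective for all faces $\tau$ of $Q_+$. (2) If $\mathrm{soc}_\tau\phi:\mathrm{soc}_\tau M\to\mathrm{soc}_\tau N$ is injective for all faces $\tau$ of $Q_+$ and $M$ is downset-finite, then $\phi$ is injective. If $M$ is downset-finite, then each nonzero homogeneous element of $M$ divides a cogenerator of $M$ (along some face, with some nadir).
   Context: A real polyhedral group is a group $Q\cong\mathbb{R}^n$ partially ordered by $q\preceq q'\iff q'-q\in Q_+$, where the positive cone $Q_+$ is an intersection of finitely many closed half-spaces, has trivial unit group, and generates $Q$. Faces are the usual nonempty faces of the cone $Q_+$ (including $\{0\}$ and $Q_+$); $\sigma^\circ$ is the relative interior of a face $\sigma$; $\mathbb{R}\tau$ is the span of $\tau$. A $Q$-module is a $Q$-graded $k$-vector space with structure maps $M_q\to M_{q'}$ for $q\preceq q'$ compatible with composition (modules over any poset are defined likewise); homomorphisms are degree-preserving and commute with structure maps. For a downset $D\subseteq Q$ (closed under going down), $k[D]$ is the module with $k$ in degrees from $D$, $0$ elsewhere, and identity structure maps inside $D$. $M$ is downset-finite if it embeds in a finite direct sum of modules of the form $k[D]$. Upper boundaries. For a face $\sigma$, $(\delta^\sigma M)_a=\varinjlim_{a'\in a-\sigma^\circ}M_{a'}$ and $\delta^\sigma M=\bigoplus_{a\in Q}(\delta^\sigma M)_a$. For $a\preceq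 b$ and faces $\sigma\supseteq\sigma'$ the structure maps of $M$ induce natural maps $(\delta^\sigma M)_a\to(\delta^{\sigma'}M)_b$. For a face $\tau$, let $\nabla\tau$ be the set of faces containing $\tau$, partially ordered by $\sigma\preceq\sigma'\iff\sigma\supseteq\sigma'$. Then $\delta_\tau M=\bigoplus_{\sigma\in\nabla\tau}\delta^\sigma M$ is a module over $Q\times\nabla\tau$. Quotient-restriction. For a $Q$-module $N$, the localization $N_\tau=N\otimes_{k[Q_+]}k[Q_++\mathbb{R}\tau]$ has $(N_\tau)_a=\varinjlim_{v\in\tau}N_{a+v}$; $\mathbb{R}\tau$ acts on it by isomorphisms, and $N/\tau$ is the $Q/\mathbb{R}\tau$-module whose component in degree $\tilde a=a+\mathbb{R}\tau$ is $(N_\tau)_a$, identified for all $a\in\tilde a$ via this action. The same operation applies to $Q\times\nabla\tau$-modules, componentwise over $\nabla\tau$. Socles. For $(a,\sigma)\in Q\times\nabla\tau$ let $k_\sigma[a+\tau]$ be the $Q\times\nabla\tau$-module with $k$ in degrees $(a+v,\sigma)$, $v\in\tau$, identity maps between these, and $0$ elsewhere. Set $\underline{\mathrm{Hom}}_{Q\times\nabla\tau}(k[\tau],-)=\bigoplus_{(a,\sigma)}\mathrm{Hom}_{Q\times\nabla\tau}(k_\sigma[a+\tau],-)$; applied to $\delta_\tau M$ it is regarded as a submodule of $\delta_\tau M$ via $\phi\mapsto\phi(1)$. The socle of $M$ along $\tau$ is $\mathrm{soc}_\tau M=\underline{\mathrm{Hom}}_{Q\times\nabla\tau}(k[\tau],\delta_\tau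 M)/\tau$, a module over $Q/\mathbb{R}\tau\times\nabla\tau$, functorial in $M$; its component over $\sigma\in\nabla\tau$ is $\mathrm{soc}_\tau^\sigma M$. A cogenerator of $M$ along $\tau$ with nadir $\sigma$ is a homogeneous element of $\delta^\sigma M$ that lies in the submodule $\underline{\mathrm{Hom}}_{Q\times\nabla\tau}(k[\tau],\delta_\tau M)$ and has nonzero image in $\mathrm{soc}_\tau M$. Divisibility. An element $y\in M_b$ divides $x\in(\delta^\sigma M)_a$ if $b\in a-\sigma^\circ-Q_+$ and $y\mapsto x$ under the natural map $M_b\to(\delta^\sigma M)_a$. *)

(* Defs.v *)
From HB Require Import structures.
From mathcomp Require Import all_boot all_order all_algebra.
From mathcomp Require Import boolp classical_sets reals topology normedtype.
From mathcomp Require Import ring lra.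

Set Implicit Arguments.
Unset Strict Implicit.
Unset Printing Implicit Defensive.

Import Order.TTheory GRing.Theory Num.Theory.
Import numFieldNormedType.Exports.

Local Open Scope classical_set_scope.
Local Open Scope order_scope.
Local Open Scope ring_scope.
Local Open Scope quotient_scope.

Local Notation "x <=p y" := (Order.le x y) (at level 70).

Identity Coercion set_to_fun : set >-> Funclass.

Section PosetModules.
Context (k : fieldType) (d : Order.disp_t) (P : porderType d).

Record pmod := PMod {
  pcomp :> P -> lmodType k;
  pstr : forall a b, a <=p b -> {linear pcomp a -> pcomp b};
  pstr_id : forall a (h : a <=p a) x, pstr h x = x;
  pstr_comp : forall a b c (ab : a <=p b) (bc : b <=p c) (ac : a <=p c) x,
    pstr bc (pstr ab x) = pstr ac x }.

Record phom (M N : pmod) := PHom {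
  pfun :> forall a, {linear M a -> N a};
  pnat : forall a b (ab : a <=p b) x, pfun b (pstr M ab x) = pstr N ab (pfun a x) }.

Definition pinjective (M N : pmod) (phi : phom M N) :=
  forall a, injective (phi a).

Record directed := Directed {
  dset :> set P;
  dset_neq0 : dset !=set0;
  dset_ub : forall i j, dset i -> dset j ->
    exists2 l, dset l & i <=p l /\ j <=p l }.

Definition below (D : set P) (b : P) := exists2 i, D i & b <=p i.

End PosetModules.

Arguments pstr {k d P} M [a b] ab : rename.

Section DirectLimit.
Context (k : fieldType) (d : Order.disp_t) (P : porderType d).
Context (M : pmod k P) (D : directed P).

Definition dlim_pre := {i : {i : P | `[< D i >]} & M (val i)}.

Definition mk_pre i (Di : D i) (x : M i) : dlim_pre :=
  existT (fun i : {i : P | `[< D i >]} => M (val i)) (exist _ i (asboolT Di)) x.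

Definition dlim_eqv (x y : dlim_pre) : bool :=
  `[< exists2 l, D l & exists (h1 : val (tag x) <=p l) (h2 : val (tag y) <=p l),
      pstr M h1 (tagged x) = pstr M h2 (tagged y) >].

Lemma dlim_eqv_refl : reflexive dlim_eqv.
Proof.
move=> [[i Di] x]; apply/asboolP; exists i; first exact/asboolP.
by exists (lexx _), (lexx _).
Qed.

Lemma dlim_eqv_sym : symmetric dlim_eqv.
Proof.
by move=> x y; apply/asboolP/asboolP => -[l Dl [h1 [h2 e]]]; exists l => //; exists h2, h1.
Qed.

Lemma dlim_eqv_trans : transitive dlim_eqv.
Proof.
move=> y x z /asboolP[l Dl [h1 [h2 e]]] /asboolP[m Dm [h3 [h4 e']]].
have [n Dn [ln mn]] := dset_ub Dl Dm.
apply/asboolP; exists n => //; exists (le_trans h1 ln), (le_trans h4 mn).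
rewrite -(pstr_comp h1 ln) e -(pstr_comp h4 mn) -e'.
by rewrite (pstr_comp h2 ln (le_trans h2 ln)) (pstr_comp h3 mn (le_trans h2 ln)).
Qed.

Canonical dlim_equiv := EquivRel dlim_eqv dlim_eqv_refl dlim_eqv_sym dlim_eqv_trans.

Definition dlim := {eq_quot dlim_equiv}.
HB.instance Definition _ := Choice.on dlim.

Definition dlim_pi i (Di : D i) (x : M i) : dlim := \pi_{eq_quot dlim_equiv} (mk_pre Di x).

Lemma dlim_piP (x : dlim) : exists i (Di : D i) m, x = dlim_pi Di m.
Proof.
rewrite -[x]reprK; case: (repr x) => [[i bi] m].
have Di : D i by apply/asboolP.
exists i, Di, m; rewrite /dlim_pi /mk_pre.
by rewrite (Prop_irrelevance (asboolT Di) bi).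
Qed.

Lemma dlim_pi_eq i j (Di : D i) (Dj : D j) x y : dlim_pi Di x = dlim_pi Dj y <->
  exists2 l, D l & exists (h1 : i <=p l) (h2 : j <=p l), pstr M h1 x = pstr M h2 y.
Proof.
split=> [e|[l Dl [h1 [h2 e]]]].
  have /asboolP // : dlim_eqv (mk_pre Di x) (mk_pre Dj y).
  exact/eqmodP.
by apply/eqmodP/asboolP; exists l => //; exists h1, h2.
Qed.

Lemma dlim_pi_str i j (Di : D i) (Dj : D j) (h : i <=p j) x :
  dlim_pi Dj (pstr M h x) = dlim_pi Di x.
Proof.
apply/dlim_pi_eq; exists j => //; exists (lexx _), h.
by rewrite pstr_id.
Qed.

Lemma dlim_pi2P (x y : dlim) :
  exists i (Di : D i) m n, x = dlim_pi Di m /\ y = dlim_pi Di n.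
Proof.
have [i [Di [m ->]]] := dlim_piP x; have [j [Dj [n ->]]] := dlim_piP y.
have [l Dl [il jl]] := dset_ub Di Dj.
by exists l, Dl, (pstr M il m), (pstr M jl n); rewrite !dlim_pi_str.
Qed.

Lemma dlim_pi3P (x y z : dlim) : exists i (Di : D i) m n p,
  [/\ x = dlim_pi Di m, y = dlim_pi Di n & z = dlim_pi Di p].
Proof.
have [i [Di [m [n [-> ->]]]]] := dlim_pi2P x y; have [j [Dj [p ->]]] := dlim_piP z.
have [l Dl [il jl]] := dset_ub Di Dj.
by exists l, Dl, (pstr M il m), (pstr M il n), (pstr M jl p); rewrite !dlim_pi_str.
Qed.

Lemma dlim_add_ex (x y : dlim) : exists z, exists i (Di : D i) m n,
  [/\ x = dlim_pi Di m, y = dlim_pi Di n & z = dlim_pi Di (m + n)].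
Proof.
have [i [Di [m [n [-> ->]]]]] := dlim_pi2P x y.
by exists (dlim_pi Di (m + n)), i, Di, m, n.
Qed.

Definition dlim_add x y : dlim := sval (cid (dlim_add_ex x y)).

Lemma dlim_addE i (Di : D i) m n :
  dlim_add (dlim_pi Di m) (dlim_pi Di n) = dlim_pi Di (m + n).
Proof.
rewrite /dlim_add; case: cid => z [j [Dj [m' [n' [/= em en ->]]]]].
have [l Dl [il [jl e1]]] := (dlim_pi_eq _ _ _ _).1 em.
have [l' Dl' [il' [jl' e2]]] := (dlim_pi_eq _ _ _ _).1 en.
have [q Dq [lq lq']] := dset_ub Dl Dl'.
apply/esym/dlim_pi_eq; exists q => //.
exists (le_trans il lq), (le_trans jl lq); rewrite !linearD.
congr (_ + _).
  by rewrite -(pstr_comp il lq) e1 (pstr_comp jl lq (le_trans jl lq)).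
rewrite -(pstr_comp il' lq' (le_trans il lq)) e2.
by rewrite (pstr_comp jl' lq' (le_trans jl lq)).
Qed.

Lemma dlim_scale_ex (c : k) (x : dlim) : exists z, exists i (Di : D i) m,
  x = dlim_pi Di m /\ z = dlim_pi Di (c *: m).
Proof.
have [i [Di [m ->]]] := dlim_piP x.
by exists (dlim_pi Di (c *: m)), i, Di, m.
Qed.

Definition dlim_scale c x : dlim := sval (cid (dlim_scale_ex c x)).

Lemma dlim_scaleE c i (Di : D i) m :
  dlim_scale c (dlim_pi Di m) = dlim_pi Di (c *: m).
Proof.
rewrite /dlim_scale; case: cid => z [j [Dj [m' [/= em ->]]]].
have [l Dl [il [jl e1]]] := (dlim_pi_eq _ _ _ _).1 em.
apply/esym/dlim_pi_eq; exists l => //; exists il, jl.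
by rewrite !linearZ /= e1.
Qed.

Definition dlim_zero : dlim := dlim_pi (svalP (cid (dset_neq0 D))) 0.

Lemma dlim_zeroE i (Di : D i) : dlim_pi Di 0 = dlim_zero.
Proof.
rewrite /dlim_zero; case: cid => j Dj /=.
have [l Dl [il jl]] := dset_ub Di Dj.
apply/dlim_pi_eq; exists l => //; exists il, jl.
by rewrite !linear0.
Qed.

Definition dlim_opp x : dlim := dlim_scale (-1) x.

Lemma dlim_addA : associative dlim_add.
Proof.
move=> x y z; have [i [Di [m [n [p [-> -> ->]]]]]] := dlim_pi3P x y z.
by rewrite !dlim_addE addrA.
Qed.

Lemma dlim_addC : commutative dlim_add.
Proof.
move=> x y; have [i [Di [m [n [-> ->]]]]] := dlim_pi2P x y.
by rewrite !dlim_addE addrC.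
Qed.

Lemma dlim_add0 : left_id dlim_zero dlim_add.
Proof.
move=> x; have [i [Di [m ->]]] := dlim_piP x.
by rewrite -(dlim_zeroE Di) dlim_addE add0r.
Qed.

Lemma dlim_addN : left_inverse dlim_zero dlim_opp dlim_add.
Proof.
move=> x; have [i [Di [m ->]]] := dlim_piP x.
by rewrite /dlim_opp dlim_scaleE dlim_addE scaleN1r addNr dlim_zeroE.
Qed.

HB.instance Definition _ :=
  GRing.isZmodule.Build dlim dlim_addA dlim_addC dlim_add0 dlim_addN.

Lemma dlim_scaleA a b x : dlim_scale a (dlim_scale b x) = dlim_scale (a * b) x.
Proof.
by have [i [Di [m ->]]] := dlim_piP x; rewrite !dlim_scaleE scalerA.
Qed.

Lemma dlim_scale1 : left_id 1 dlim_scale.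
Proof.
by move=> x; have [i [Di [m ->]]] := dlim_piP x; rewrite dlim_scaleE scale1r.
Qed.

Lemma dlim_scaleDr : right_distributive dlim_scale +%R.
Proof.
move=> c x y; have [i [Di [m [n [-> ->]]]]] := dlim_pi2P x y.
by rewrite {1}/GRing.add /= dlim_addE !dlim_scaleE {2}/GRing.add /= dlim_addE scalerDr.
Qed.

Lemma dlim_scaleDl x : {morph dlim_scale^~ x : a b / a + b}.
Proof.
move=> a b; have [i [Di [m ->]]] := dlim_piP x.
by rewrite !dlim_scaleE /GRing.add /= dlim_addE -scalerDl.
Qed.

HB.instance Definition _ := GRing.Zmodule_isLmodule.Build k dlim
  dlim_scaleA dlim_scale1 dlim_scaleDr dlim_scaleDl.

Lemma dlim_pi_linear i (Di : D i) : linear (dlim_pi Di).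
Proof.
by move=> c m n; rewrite /GRing.scale /GRing.add /= dlim_scaleE dlim_addE.
Qed.

HB.instance Definition _ i (Di : D i) :=
  GRing.isLinear.Build k (M i) dlim *:%R (dlim_pi Di) (dlim_pi_linear Di).

Section Universal.
Context (V : lmodType k) (f : forall i, D i -> {linear M i -> V}).
Context (fC : forall i j (Di : D i) (Dj : D j) (h : i <=p j) x,
  f Dj (pstr M h x) = f Di x).

Lemma dlim_rec_ex (x : dlim) : exists v, exists i (Di : D i) m,
  x = dlim_pi Di m /\ v = f Di m.
Proof.
by have [i [Di [m ->]]] := dlim_piP x; exists (f Di m), i, Di, m.
Qed.

Definition dlim_rec (x : dlim) : V := sval (cid (dlim_rec_ex x)).

Lemma dlim_recE i (Di : D i) m : dlim_rec (dlim_pi Di m) = f Di m.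
Proof.
rewrite /dlim_rec; case: cid => v [j [Dj [n [/= e ->]]]].
have [l Dl [il [jl e1]]] := (dlim_pi_eq _ _ _ _).1 e.
by rewrite -(fC Dj Dl jl) -e1 fC.
Qed.

Lemma dlim_rec_linear : linear dlim_rec.
Proof.
move=> c x y; have [i [Di [m [n [-> ->]]]]] := dlim_pi2P x y.
by rewrite -linearP !dlim_recE linearP.
Qed.

Definition dlim_rec_lin : {linear dlim -> V} :=
  HB.pack dlim_rec (GRing.isLinear.Build k dlim V *:%R dlim_rec dlim_rec_linear).

End Universal.
End DirectLimit.

Section DirectLimitMaps.
Context (k : fieldType) (d : Order.disp_t) (P : porderType d).

Section In.
Context (M : pmod k P) (D : directed P) (b : P) (h : below D b).

Definition dlim_in (x : M b) : dlim M D :=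
  dlim_pi (s2valP (cid2 h)) (pstr M (s2valP' (cid2 h)) x).

Lemma dlim_in_linear : linear dlim_in.
Proof. by move=> c x y; rewrite /dlim_in !linearP. Qed.

HB.instance Definition _ :=
  GRing.isLinear.Build k (M b) (dlim M D) *:%R dlim_in dlim_in_linear.

Lemma dlim_inE i (Di : D i) (bi : b <=p i) x :
  dlim_in x = dlim_pi Di (pstr M bi x).
Proof.
rewrite /dlim_in; case: cid2 => j Dj bj /=.
have [l Dl [il jl]] := dset_ub Di Dj.
apply/dlim_pi_eq; exists l => //; exists jl, il.
by rewrite !(pstr_comp _ _ (le_trans bi il)).
Qed.

End In.

Lemma dlim_in_str (M : pmod k P) (D : directed P) a b (ab : a <=p b)
  (ha : below D a) (hb : below D b) (x : M a) :
  dlim_in hb (pstr M ab x) = dlim_in ha x.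
Proof.
case: (hb) => i Di bi; rewrite (dlim_inE _ Di bi) (dlim_inE _ Di (le_trans ab bi)).
by rewrite (pstr_comp _ _ (le_trans ab bi)).
Qed.

Lemma dlim_in_pi (M : pmod k P) (D : directed P) i (Di : D i) (h : below D i) (x : M i) :
  dlim_in h x = dlim_pi Di x.
Proof. by rewrite (dlim_inE _ Di (lexx i)) dlim_pi_str. Qed.

Definition dominated (D E : directed P) := forall i, D i -> below E i.

Lemma below_trans (D E : directed P) (DE : dominated D E) b : below D b -> below E b.
Proof.
by move=> -[i Di bi]; have [j Ej ij] := DE i Di; exists j => //; exact: le_trans bi ij.
Qed.

Definition dlim_map (M : pmod k P) (D E : directed P) (DE : dominated D E) :
    {linear dlim M D -> dlim M E} :=
  dlim_rec_lin (f := fun i Di => dlim_in (DE i Di) : {linear M i -> dlim M E})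
    (fun i j Di Dj h x => dlim_in_str h (DE i Di) (DE j Dj) x).

Lemma dlim_map_in (M : pmod k P) (D E : directed P) (DE : dominated D E) b
  (hD : below D b) (hE : below E b) (x : M b) :
  dlim_map M DE (dlim_in hD x) = dlim_in hE x.
Proof.
case: (hD) => i Di bi; rewrite (dlim_inE _ Di bi) /= dlim_recE; last first.
  by move=> *; exact: dlim_in_str.
exact: dlim_in_str.
Qed.

Lemma dlim_map_pi (M : pmod k P) (D E : directed P) (DE : dominated D E) i (Di : D i)
  (x : M i) : dlim_map M DE (dlim_pi Di x) = dlim_in (DE i Di) x.
Proof.
have h : below D i by exists i.
by rewrite -(dlim_in_pi Di h) (dlim_map_in DE h (DE i Di)).
Qed.

Section Functor.
Context (M N : pmod k P) (phi : phom M N) (D : directed P).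

Let g i (Di : D i) (x : M i) : dlim N D := dlim_pi Di (phi i x).

Let g_linear i (Di : D i) : linear (g Di).
Proof. by move=> c x y; rewrite /g !linearP. Qed.

Let gl i (Di : D i) : {linear M i -> dlim N D} :=
  HB.pack (g Di) (GRing.isLinear.Build k (M i) (dlim N D) *:%R (g Di) (g_linear Di)).

Let glC i j (Di : D i) (Dj : D j) (h : i <=p j) x : gl Dj (pstr M h x) = gl Di x.
Proof. by rewrite /= /g pnat dlim_pi_str. Qed.

Definition dlim_fun : {linear dlim M D -> dlim N D} := dlim_rec_lin glC.

Lemma dlim_fun_pi i (Di : D i) x : dlim_fun (dlim_pi Di x) = dlim_pi Di (phi i x).
Proof. by rewrite /= (dlim_recE glC). Qed.

Lemma dlim_fun_in b (h : below D b) x : dlim_fun (dlim_in h x) = dlim_in h (phi b x).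
Proof.
case: (h) => i Di bi; rewrite !(dlim_inE _ Di bi).
by rewrite dlim_fun_pi pnat.
Qed.

End Functor.

Section Family.
Context (d' : Order.disp_t) (P' : porderType d') (F : P' -> directed P).
Context (Fmono : forall a b, a <=p b -> dominated (F a) (F b)).

Section Obj.
Context (M : pmod k P).

Lemma dlim_pmod_id a (h : a <=p a) (x : dlim M (F a)) : dlim_map M (Fmono h) x = x.
Proof.
have [i [Di [m ->]]] := dlim_piP x.
by rewrite dlim_map_pi (dlim_in_pi Di).
Qed.

Lemma dlim_pmod_comp a b c (ab : a <=p b) (bc : b <=p c) (ac : a <=p c)
  (x : dlim M (F a)) :
  dlim_map M (Fmono bc) (dlim_map M (Fmono ab) x) = dlim_map M (Fmono ac) x.
Proof.
have [i [Di [m ->]]] := dlim_piP x.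
rewrite [dlim_map _ (Fmono ab) _]dlim_map_pi [RHS]dlim_map_pi; exact: dlim_map_in.
Qed.

Definition dlim_pmod : pmod k P' := PMod dlim_pmod_id dlim_pmod_comp.

End Obj.

Section Mor.
Context (M N : pmod k P) (phi : phom M N).

Lemma dlim_phom_nat a b (ab : a <=p b) (x : dlim_pmod M a) :
  dlim_fun phi (F b) (pstr (dlim_pmod M) ab x) =
  pstr (dlim_pmod N) ab (dlim_fun phi (F a) x).
Proof.
have [i [Di [m ->]]] := dlim_piP x.
by rewrite dlim_map_pi dlim_fun_pi dlim_map_pi dlim_fun_in.
Qed.

Definition dlim_phom : phom (dlim_pmod M) (dlim_pmod N) :=
  @PHom k d' P' (dlim_pmod M) (dlim_pmod N) (fun a => dlim_fun phi (F a)) dlim_phom_nat.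

End Mor.
End Family.
End DirectLimitMaps.

Section DirectSum.
Context (k : fieldType) (d : Order.disp_t) (P : porderType d).

Definition pzero : pmod k P :=
  @PMod k d P (fun=> 'rV[k]_0) (fun _ _ _ => idfun : {linear 'rV[k]_0 -> 'rV[k]_0})
    (fun _ _ _ => erefl) (fun _ _ _ _ _ _ _ => erefl).

Section Binary.
Context (M N : pmod k P).

Definition psum_str a b (ab : a <=p b) (x : M a * N a) : M b * N b :=
  (pstr M ab x.1, pstr N ab x.2).

Lemma psum_str_linear a b (ab : a <=p b) : linear (psum_str ab).
Proof. by move=> c x y; rewrite /psum_str /= !linearP. Qed.

HB.instance Definition _ a b (ab : a <=p b) :=
  GRing.isLinear.Build k (M a * N a)%type (M b * N b)%type *:%R
    (psum_str ab) (psum_str_linear ab).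

Lemma psum_str_id a (h : a <=p a) x : psum_str h x = x.
Proof. by case: x => x y; rewrite /psum_str !pstr_id. Qed.

Lemma psum_str_comp a b c (ab : a <=p b) (bc : b <=p c) (ac : a <=p c) x :
  psum_str bc (psum_str ab x) = psum_str ac x.
Proof. by rewrite /psum_str /= !(pstr_comp _ _ ac). Qed.

Definition psum : pmod k P :=
  @PMod k d P (fun a => (M a * N a)%type : lmodType k)
    (fun a b ab => psum_str ab : {linear _ -> _}) psum_str_id psum_str_comp.

End Binary.

Definition pdirect_sum (s : seq (pmod k P)) : pmod k P := foldr psum pzero s.

End DirectSum.

Section Submodules.
Context (k : fieldType) (d : Order.disp_t) (P : porderType d).

Record psub (M : pmod k P) := PSub {
  psub_set :> forall a, set (M a);
  psub0 : forall a, psub_set (0 : M a);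
  psub_lin : forall a c (x y : M a), psub_set x -> psub_set y -> psub_set (c *: x + y);
  psub_str : forall a b (ab : a <=p b) x, psub_set x -> psub_set (pstr M ab x) }.

Section Comp.
Context (M : pmod k P) (S : psub M) (a : P).

Definition psub_pred : {pred M a} := fun x => `[< psub_set S x >].

Lemma psub_submod_closed : submod_closed psub_pred.
Proof.
split; first exact/asboolP/psub0.
by move=> c x y /asboolP Sx /asboolP Sy; apply/asboolP; exact: psub_lin.
Qed.

HB.instance Definition _ :=
  GRing.isSubmodClosed.Build k (M a) psub_pred psub_submod_closed.

Record psub_comp := PSubComp { psub_val :> M a; psub_valP : psub_val \in psub_pred }.

HB.instance Definition _ := [isSub for psub_val].
HB.instance Definition _ := [Choice of psub_comp by <:].
HB.instance Definition _ := [SubChoice_isSubLmodule of psub_comp by <:].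

Definition psub_mk (x : M a) (Sx : psub_set S x) : psub_comp := PSubComp (asboolT Sx).

End Comp.

Section Pmod.
Context (M : pmod k P) (S : psub M).

Lemma psub_compP a (x : psub_comp S a) : psub_set S (psub_val x).
Proof. by apply/asboolP; exact: psub_valP. Qed.

Definition psub_pstr a b (ab : a <=p b) (x : psub_comp S a) : psub_comp S b :=
  psub_mk (psub_str ab (psub_compP x)).

Lemma psub_pstr_linear a b (ab : a <=p b) : linear (psub_pstr ab).
Proof. by move=> c x y; apply: val_inj; rewrite /= linearP. Qed.

HB.instance Definition _ a b (ab : a <=p b) :=
  GRing.isLinear.Build k (psub_comp S a) (psub_comp S b) *:%R
    (psub_pstr ab) (psub_pstr_linear ab).

Lemma psub_pstr_id a (h : a <=p a) x : psub_pstr h x = x.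
Proof. by apply: val_inj; rewrite /= pstr_id. Qed.

Lemma psub_pstr_comp a b c (ab : a <=p b) (bc : b <=p c) (ac : a <=p c) x :
  psub_pstr bc (psub_pstr ab x) = psub_pstr ac x.
Proof. by apply: val_inj; rewrite /= (pstr_comp _ _ ac). Qed.

Definition psub_pmod : pmod k P :=
  @PMod k d P (fun a => psub_comp S a) (fun a b ab => psub_pstr ab : {linear _ -> _})
    psub_pstr_id psub_pstr_comp.

End Pmod.

Section Mor.
Context (M N : pmod k P) (phi : phom M N) (S : psub M) (T : psub N).
Context (ST : forall a (x : M a), psub_set S x -> psub_set T (phi a x)).

Definition psub_fun a (x : psub_comp S a) : psub_comp T a :=
  psub_mk (ST (psub_compP x)).

Lemma psub_fun_linear a : linear (@psub_fun a).
Proof. by move=> c x y; apply: val_inj; rewrite /= linearP. Qed.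

HB.instance Definition _ a :=
  GRing.isLinear.Build k (psub_comp S a) (psub_comp T a) *:%R
    (@psub_fun a) (@psub_fun_linear a).

Lemma psub_fun_nat a b (ab : a <=p b) (x : psub_pmod S a) :
  psub_fun (pstr (psub_pmod S) ab x) = pstr (psub_pmod T) ab (psub_fun x).
Proof. by apply: val_inj; rewrite /= pnat. Qed.

Definition psub_phom : phom (psub_pmod S) (psub_pmod T) :=
  @PHom k d P (psub_pmod S) (psub_pmod T)
    (fun a => @psub_fun a : {linear _ -> _}) psub_fun_nat.

End Mor.
End Submodules.

Section IndicatorModules.
Context (k : fieldType) (d : Order.disp_t) (P : porderType d).

Record convex_subset := ConvexSubset {
  cset :> set P;
  cset_convex : forall a b c, a <=p b -> b <=p c -> cset a -> cset c -> cset b }.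

Record downset := Downset {
  downset_set :> set P;
  downset_closed : forall a b, a <=p b -> downset_set b -> downset_set a }.

Definition convex_of_downset (D : downset) : convex_subset :=
  @ConvexSubset D (fun a b c _ bc _ Dc => downset_closed bc Dc).

Coercion convex_of_downset : downset >-> convex_subset.

(* Dimension 1 on S and 0 off S; [const_mx 1] is the identity of k when both
   degrees lie in S and is necessarily the zero map otherwise. *)
Section Indicator.
Context (S : convex_subset).

Definition ind_dim (a : P) : nat := `[< S a >].

Definition ind_str a b (ab : a <=p b) (x : 'rV[k]_(ind_dim a)) : 'rV[k]_(ind_dim b) :=
  x *m const_mx 1.

Lemma ind_str_linear a b (ab : a <=p b) : linear (ind_str ab).
Proof. by move=> c x y; rewrite /ind_str mulmxDl scalemxAl. Qed.

HB.instance Definition _ a b (ab : a <=p b) :=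
  GRing.isLinear.Build k 'rV[k]_(ind_dim a) 'rV[k]_(ind_dim b) *:%R
    (ind_str ab) (ind_str_linear ab).

Lemma ind_str_id a (h : a <=p a) x : ind_str h x = x.
Proof.
rewrite /ind_str -[RHS]mulmx1; congr (_ *m _); apply/matrixP.
by rewrite /ind_dim; case: `[< _ >] => -[i hi] [j hj] //; rewrite !mxE !ord1.
Qed.

Lemma ind_str_comp a b c (ab : a <=p b) (bc : b <=p c) (ac : a <=p c) x :
  ind_str bc (ind_str ab x) = ind_str ac x.
Proof.
rewrite /ind_str -mulmxA; congr (_ *m _).
have : `[< S a >] -> `[< S c >] -> `[< S b >].
  by move=> /asboolP Sa /asboolP Sc; apply/asboolP; exact: cset_convex ab bc Sa Sc.
rewrite /ind_dim; case: `[< S a >]; case: `[< S b >]; case: `[< S c >] => h;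
  apply/matrixP => -[i hi] [j hj] //; last by have := h isT isT.
by rewrite !mxE big_ord1 !mxE mulr1.
Qed.

Definition ind_pmod : pmod k P :=
  @PMod k d P (fun a => 'rV[k]_(ind_dim a))
    (fun a b ab => ind_str ab : {linear _ -> _}) ind_str_id ind_str_comp.

Definition ind_one (a : P) : ind_pmod a := const_mx 1.

End Indicator.

Definition downset_finite (M : pmod k P) := exists (s : seq downset)
  (iota : phom M (pdirect_sum [seq ind_pmod D | D : downset <- s])), pinjective iota.

End IndicatorModules.

Arguments ind_pmod k {d P} S.
Arguments ind_one k {d P} S a.

Section HomSubmodule.
Context (k : fieldType) (d : Order.disp_t) (P : porderType d).
Context (F : P -> convex_subset P).
Context (F_self : forall p, F p p) (F_ge : forall p q, F p q -> p <=p q).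
Context (F_sub : forall p q r, F p q -> F p r -> q <=p r -> F q r).

(* Elements phi(1), for phi a homomorphism k[F p] -> L and 1 in degree p. *)
Definition hom_img (L : pmod k P) p : set (L p) :=
  [set x | exists phi : phom (ind_pmod k (F p)) L, phi p (ind_one k (F p) p) = x].

Lemma hom_imgP (L : pmod k P) p (x : L p) :
  hom_img x <-> forall q (pq : p <=p q), ~ F p q -> pstr L pq x = 0.
Proof.
split=> [[phi <-] q pq nF|x0].
  rewrite -pnat; set y := pstr _ _ _.
  suff -> : y = 0 by rewrite linear0.
  apply/matrixP => i j; case: j => j; rewrite /ind_dim => hj.
  by exfalso; move: hj; rewrite (asboolF nF).
pose f q (v : ind_pmod k (F p) q) : L q :=
  if pselect (p <=p q) is left h then (\sum_j v 0 j) *: pstr L h x else 0.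
have fl q : linear (@f q).
  move=> c u v; rewrite /f; case: pselect => h; last by rewrite scaler0 addr0.
  rewrite scalerA -scalerDl; congr (_ *: _).
  by rewrite mulr_sumr -big_split; apply: eq_bigr => j _; rewrite !mxE.
pose fL q : {linear ind_pmod k (F p) q -> L q} :=
  HB.pack (@f q) (GRing.isLinear.Build k (ind_pmod k (F p) q) (L q) *:%R _ (fl q)).
have fN a b (ab : a <=p b) v : fL b (pstr _ ab v) = pstr L ab (fL a v).
  have [Fa|nFa] := pselect (F p a); last first.
    suff -> : v = 0 by rewrite !linear0.
    apply/matrixP => i j; case: j => j; rewrite /ind_dim => hj.
    by exfalso; move: hj; rewrite (asboolF nFa).
  rewrite /= /f.
  have pa := F_ge Fa.
  case: pselect => [pb|npb]; last by case: npb; exact: le_trans pa ab.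
  case: pselect => // pa'; rewrite linearZ /= (pstr_comp _ _ pb).
  have [Fb|nFb] := pselect (F p b); last by rewrite x0 // !scaler0.
  congr (_ *: _); move: v; rewrite /ind_str /= /ind_dim (asboolT Fa) (asboolT Fb) => v.
  by rewrite !big_ord1 !mxE big_ord1 !mxE mulr1.
exists (PHom fN); rewrite /= /f; case: pselect => [h|]; last by rewrite lexx.
rewrite pstr_id /ind_one /ind_dim (asboolT (F_self p)) big_ord1 mxE scale1r //.
Qed.

Section Obj.
Context (L : pmod k P).

Lemma hom_img0 p : hom_img (0 : L p).
Proof. by apply/hom_imgP => q pq _; rewrite linear0. Qed.

Lemma hom_img_lin p c (x y : L p) : hom_img x -> hom_img y -> hom_img (c *: x + y).
Proof.
move=> /hom_imgP hx /hom_imgP hy; apply/hom_imgP => q pq nF.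
by rewrite linearP /= hx // hy // scaler0 addr0.
Qed.

Lemma hom_img_str p q (pq : p <=p q) (x : L p) : hom_img x -> hom_img (pstr L pq x).
Proof.
move=> /hom_imgP hx; apply/hom_imgP => r qr nF.
have [Fpq|nFpq] := pselect (F p q); last by rewrite hx // linear0.
rewrite (pstr_comp _ _ (le_trans pq qr)) hx // => Fpr.
by apply: nF; exact: F_sub Fpq Fpr qr.
Qed.

Definition hom_psub : psub L := PSub hom_img0 hom_img_lin hom_img_str.

End Obj.

Lemma hom_psub_phom (L L' : pmod k P) (phi : phom L L') p (x : L p) :
  psub_set (hom_psub L) x -> psub_set (hom_psub L') (phi p x).
Proof.
by move=> /hom_imgP hx; apply/hom_imgP => q pq nF; rewrite -pnat hx // linear0.
Qed.

End HomSubmodule.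

Section Span.
Context (R : realType) (n : nat).
Implicit Types A : set 'rV[R]_n.

Definition lspan A : set 'rV[R]_n :=
  [set x | exists2 X : seq 'rV[R]_n, (forall y, y \in X -> A y) & x \in <<X>>%VS].

(* Relative interior of a set containing 0, whose affine hull is its linear span. *)
Definition relint A : set 'rV[R]_n :=
  [set x | A x /\ \forall y \near x, lspan A y -> A y].

Lemma nbhs_rV (x : 'rV[R]_n) (U : set 'rV[R]_n) : nbhs x U <->
  exists2 e : R, 0 < e & forall y : 'rV[R]_n, (forall j, `|x 0 j - y 0 j| < e) -> U y.
Proof.
split=> [/nbhs_ballP[e /= e0 h]|[e e0 h]].
  exists e => // y hy; apply: h; split=> // i j; rewrite !ord1; exact: hy.
apply/nbhs_ballP; exists e => //= y [_ hy]; apply: h => j; exact: hy.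
Qed.

End Span.

Section Groups.
Context (R : realType) (n : nat).

(* The columns of A are the inner normals of the half-spaces. *)
Record polycone := PolyCone {
  pos :> set 'rV[R]_n;
  pos_halfspaces : exists m (A : 'M[R]_(n, m)),
    pos = [set q | forall i, 0 <= (q *m A) 0 i];
  pos_unit : forall q, pos q -> pos (- q) -> q = 0;
  pos_gen : forall q, exists u v, [/\ pos u, pos v & q = u - v] }.

Definition realpoly (C : polycone) : Type := 'rV[R]_n.
HB.instance Definition _ C := GRing.Lmodule.on (realpoly C).

Section Cone.
Context (C : polycone).

Lemma pos0 : pos C 0.
Proof. by have [m [A ->]] := pos_halfspaces C => i; rewrite mul0mx mxE. Qed.

Lemma posD u v : pos C u -> pos C v -> pos C (u + v).
Proof.
have [m [A ->]] := pos_halfspaces C => hu hv i.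
by rewrite mulmxDl mxE addr_ge0.
Qed.

Lemma posZ c u : 0 <= c -> pos C u -> pos C (c *: u).
Proof.
have [m [A ->]] := pos_halfspaces C => c0 hu i.
by rewrite -scalemxAl mxE mulr_ge0.
Qed.

Definition rp_le (q q' : realpoly C) : bool := `[< pos C (q' - q) >].

Lemma rp_le_refl : reflexive rp_le.
Proof. by move=> q; apply/asboolP; rewrite subrr; exact: pos0. Qed.

Lemma rp_le_anti : antisymmetric rp_le.
Proof.
move=> x y /andP[/asboolP xy /asboolP yx]; apply/esym/eqP; rewrite -subr_eq0.
by apply/eqP/(pos_unit xy); rewrite opprB.
Qed.

Lemma rp_le_trans : transitive rp_le.
Proof.
move=> y x z /asboolP xy /asboolP yz; apply/asboolP.
by rewrite -(subrKA y); exact: posD.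
Qed.

HB.instance Definition _ := Order.Le_isPOrder.Build (Order.Disp tt tt) (realpoly C)
  rp_le_refl rp_le_anti rp_le_trans.

Lemma rp_leP (a b : realpoly C) : (a <=p b) <-> pos C (b - a).
Proof. by split=> /asboolP. Qed.

(* A nonempty face is cut out by a supporting hyperplane through the origin;
   l = 0 gives the whole cone. *)
Record face := Face {
  face_set :> set 'rV[R]_n;
  face_exposed : exists2 l : 'cV[R]_n,
    forall q, pos C q -> 0 <= (q *m l) 0 0 &
    face_set = [set q | pos C q /\ (q *m l) 0 0 = 0] }.

HB.instance Definition _ := gen_eqMixin face.
HB.instance Definition _ := gen_choiceMixin face.

Lemma face_inj (s t : face) : face_set s = face_set t -> s = t.
Proof.
case: s t => [s hs] [t ht] /= e; case: t / e ht => ht.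
by rewrite (Prop_irrelevance hs ht).
Qed.

Definition face_le (s t : face) : bool := `[< face_set t `<=` face_set s >].

Lemma face_le_refl : reflexive face_le.
Proof. by move=> s; apply/asboolP. Qed.

Lemma face_le_anti : antisymmetric face_le.
Proof.
by move=> s t /andP[/asboolP ts /asboolP st]; apply/face_inj/seteqP; split.
Qed.

Lemma face_le_trans : transitive face_le.
Proof.
by move=> s t u /asboolP st /asboolP us; apply/asboolP; exact: subset_trans us st.
Qed.

(* Faces are ordered by reverse inclusion. *)
HB.instance Definition _ := Order.Le_isPOrder.Build (Order.Disp tt tt) face
  face_le_refl face_le_anti face_le_trans.

Record nabla (tau : face) := Nabla {
  nabla_face :> face;
  nablaP : `[< face_set tau `<=` face_set nabla_face >] }.

HB.instance Definition _ tau := [isSub for @nabla_face tau].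
HB.instance Definition _ tau := [Choice of nabla tau by <:].
HB.instance Definition _ tau := [SubChoice_isSubPOrder of nabla tau by <: with Order.Disp tt tt].

Section Face.
Context (s : face).

Lemma face_pos u : face_set s u -> pos C u.
Proof. by have [l _ ->] := face_exposed s; case. Qed.

Lemma face0 : face_set s 0.
Proof.
have [l _ ->] := face_exposed s; split; first exact: pos0.
by rewrite mul0mx mxE.
Qed.

Lemma faceD u v : face_set s u -> face_set s v -> face_set s (u + v).
Proof.
have [l _ ->] := face_exposed s => -[pu lu] [pv lv]; split; first exact: posD.
by rewrite mulmxDl mxE lu lv addr0.
Qed.

Lemma faceZ c u : 0 <= c -> face_set s u -> face_set s (c *: u).
Proof.
have [l _ ->] := face_exposed s => c0 [pu lu]; split; first exact: posZ.
by rewrite -scalemxAl mxE lu mulr0.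
Qed.

Lemma face_addl u v : pos C u -> pos C v -> face_set s (u + v) -> face_set s u.
Proof.
have [l l0 ->] := face_exposed s => pu pv [_ e]; split=> //.
apply/eqP; rewrite eq_le l0 // andbT.
by move: e; rewrite mulmxDl mxE => /eqP; rewrite addr_eq0 => /eqP ->; rewrite oppr_le0 l0.
Qed.

Lemma face_sum (I : Type) (r : seq I) (Q : pred I) (f : I -> 'rV[R]_n) :
  (forall i, Q i -> face_set s (f i)) -> face_set s (\sum_(i <- r | Q i) f i).
Proof. by move=> h; elim/big_ind: _ => //; [exact: face0|exact: faceD]. Qed.

Lemma lspan_sub u : face_set s u -> lspan s u.
Proof.
move=> su; exists [:: u] => [y|]; first by rewrite inE => /eqP ->.
by rewrite span_seq1 memv_line.
Qed.

Lemma lspanP x :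
  lspan s x <-> exists u v, [/\ face_set s u, face_set s v & x = u - v].
Proof.
split=> [[X hX xX]|[u [v [su sv ->]]]]; last first.
  exists [:: u; v] => [y|]; first by rewrite !inE => /orP[] /eqP ->.
  by rewrite memvB // memv_span // !inE eqxx ?orbT.
pose c i := coord (in_tuple X) i x.
have ex : x = \sum_i c i *: (in_tuple X)`_i by exact: (coord_span (X := in_tuple X)).
have sX (i : 'I_(size X)) : face_set s (in_tuple X)`_i by apply/hX/mem_nth.
exists (\sum_i Num.max (c i) 0 *: (in_tuple X)`_i),
       (\sum_i Num.max (- c i) 0 *: (in_tuple X)`_i); split.
- by apply: face_sum => i _; apply: faceZ; rewrite ?le_max ?lexx ?orbT.
- by apply: face_sum => i _; apply: faceZ; rewrite ?le_max ?lexx ?orbT.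
rewrite -sumrB {1}ex; apply: eq_bigr => i _; rewrite -scalerBl; congr (_ *: _).
have [h|h] := leP 0 (c i).
  by rewrite max_r ?oppr_le0 // subr0.
by rewrite max_l ?oppr_ge0 ?ltW // opprK add0r.
Qed.

Lemma lspan0 : lspan s 0.
Proof. exact/lspan_sub/face0. Qed.

Lemma lspanD x y : lspan s x -> lspan s y -> lspan s (x + y).
Proof.
move=> /lspanP[u [v [su sv ->]]] /lspanP[u' [v' [su' sv' ->]]]; apply/lspanP.
by exists (u + u'), (v + v'); rewrite addrACA opprD; split=> //; exact: faceD.
Qed.

Lemma lspanN x : lspan s x -> lspan s (- x).
Proof.
by move=> /lspanP[u [v [su sv ->]]]; apply/lspanP; exists v, u; rewrite opprB.
Qed.

Lemma lspanZ c x : lspan s x -> lspan s (c *: x).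
Proof. by move=> [X hX xX]; exists X => //; exact: memvZ. Qed.

Lemma face_relint_sub u : relint s u -> face_set s u.
Proof. by case. Qed.

Lemma relint_absorb u v : relint s u -> lspan s v ->
  exists2 e : R, 0 < e <= 1 & face_set s (u - e *: v).
Proof.
move=> [su /nbhs_rV[r r0 h]] sv.
pose K := 1 + \sum_j `|v 0 j|.
have K1 : 1 <= K by rewrite lerDl sumr_ge0.
have K0 : 0 < K by exact: lt_le_trans K1.
pose e := Num.min 1 (r / (K + K)).
have e0 : 0 < e by rewrite /e lt_min ltr01 divr_gt0 // addr_gt0.
exists e; first by rewrite e0 /e ge_min lexx.
apply: h => [j|]; last by apply/lspanD/lspanN/lspanZ => //; exact: lspan_sub.
rewrite !mxE opprB addrC subrK normrM (gtr0_norm e0).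
have vj : `|v 0 j| < K + K.
  have : `|v 0 j| <= \sum_j `|v 0 j|.
    by rewrite (bigD1 j) //= lerDl sumr_ge0.
  rewrite /K in K0 *; lra.
have he : e <= r / (K + K) by rewrite /e ge_min lexx orbT.
apply: (@lt_le_trans _ _ (e * (K + K))); first by rewrite ltr_pM2l.
by rewrite -ler_pdivlMr // addr_gt0.
Qed.

Lemma relintZ c u : 0 < c -> relint s u -> relint s (c *: u).
Proof.
move=> c0 [su /nbhs_rV[r r0 h]]; split; first by apply: faceZ => //; exact: ltW.
apply/nbhs_rV; exists (c * r) => [|y hy sy]; first exact: mulr_gt0.
have -> : y = c *: (c^-1 *: y) by rewrite scalerA divff ?scale1r // gt_eqF.
apply: faceZ; first exact: ltW.
apply: h => [j|]; last exact: lspanZ.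
have := hy j; rewrite !mxE => hj.
rewrite -(ltr_pM2l c0); apply: le_lt_trans hj.
by rewrite -{1}(gtr0_norm c0) -normrM mulrBr mulrA divff ?mul1r // gt_eqF.
Qed.

Lemma face_basis : exists2 X : seq 'rV[R]_n, (forall y, y \in X -> face_set s y) &
  forall y, face_set s y -> y \in <<X>>%VS.
Proof.
apply: contrapT => nX.
have big : forall m, exists2 X : seq 'rV[R]_n, (forall y, y \in X -> face_set s y) &
    (m <= \dim <<X>>)%N.
  elim=> [|m [X hX mX]]; first by exists [::].
  have [y [sy yX]] : exists y, face_set s y /\ y \notin <<X>>%VS.
    apply: contrapT => ne; apply: nX; exists X => // y sy.
    by apply/negPn/negP => yX; apply: ne; exists y.
  exists (y :: X) => [z|].
    by rewrite inE => /orP[/eqP ->|]; [|exact: hX].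
  apply: leq_ltn_trans mX _; rewrite span_cons.
  rewrite ltn_neqAle dimvS ?addvSr // andbT.
  apply/negP => /eqP e.
  have /eqP eV : (<<X>> == <[y]> + <<X>>)%VS by rewrite eqEdim addvSr e leqnn.
  by move: yX; rewrite eV (subvP (addvSl _ _) _ (memv_line y)).
have [X _] := big (\dim {: 'rV[R]_n}).+1.
by rewrite leqNgt ltnS dimvS ?subvf.
Qed.

Lemma relint_neq0 : relint s !=set0.
Proof.
have [X hX sX] := face_basis; set T := in_tuple X.
have sT (i : 'I_(size X)) : face_set s T`_i by apply/hX/mem_nth.
exists (\sum_(i < size X) T`_i); split; first by apply: face_sum.
pose K := 1 + \sum_(i < size X) \sum_j `|coord T i (delta_mx 0 j)|.
have S0 : 0 <= \sum_i \sum_j `|coord T i (delta_mx 0 j)|.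
  by apply: sumr_ge0 => i _; exact: sumr_ge0.
have K0 : 0 < K by rewrite ltr_pwDl.
apply/nbhs_rV; exists K^-1 => [|y hy sy]; first by rewrite invr_gt0.
have yX : y \in <<X>>%VS.
  move/lspanP: sy => [u [v [su sv ->]]]; apply: memvB; exact: sX.
pose z := y - \sum_(i < size X) T`_i.
have zX : z \in <<T>>%VS.
  by apply: memvB => //; apply: memv_suml => i _; exact/memv_span/mem_nth.
have -> : y = \sum_(i < size X) (1 + coord T i z) *: T`_i.
  under eq_bigr do rewrite scalerDl scale1r.
  by rewrite big_split /= -(coord_span zX) addrC subrK.
apply: face_sum => i _; apply: faceZ => //.
suff : `|coord T i z| <= 1 by rewrite ler_norml => /andP[h _]; rewrite -lerBlDl sub0r.
rewrite (row_sum_delta z) linear_sum; apply: le_trans (ler_norm_sum _ _ _) _.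
apply: (@le_trans _ _ (\sum_j K^-1 * `|coord T i (delta_mx 0 j)|)).
  apply: ler_sum => j _; rewrite linearZ normrM ler_wpM2r //.
  by rewrite /z !mxE distrC ltW // -[X in _ - X]opprK; move: (hy j); rewrite !mxE ?opprK.
rewrite -mulr_sumr mulrC ler_pdivrMr // mul1r /K.
apply: (@le_trans _ _ (\sum_i \sum_j `|coord T i (delta_mx 0 j)|)).
  rewrite [leRHS](bigD1 i) //= lerDl; apply: sumr_ge0 => i' _; exact: sumr_ge0.
by rewrite lerDr.
Qed.

End Face.
End Cone.
End Groups.

Local Ltac rv_ring := apply/rowP => ?; rewrite !mxE; ring.

Section QuotientGroup.
Context (R : realType) (n : nat) (C : polycone R n) (tau : face C).

Definition rp_cong (a b : realpoly C) : bool := `[< lspan tau (a - b) >].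

Lemma rp_cong_refl : reflexive rp_cong.
Proof. by move=> a; apply/asboolP; rewrite subrr; exact: lspan0. Qed.

Lemma rp_cong_sym : symmetric rp_cong.
Proof.
by move=> a b; apply/asboolP/asboolP => /lspanN; rewrite opprB.
Qed.

Lemma rp_cong_trans : transitive rp_cong.
Proof.
move=> b a c /asboolP ab /asboolP bc; apply/asboolP.
by rewrite -(subrKA b); exact: lspanD.
Qed.

Canonical rp_cong_equiv := EquivRel rp_cong rp_cong_refl rp_cong_sym rp_cong_trans.

Definition rpquot := {eq_quot rp_cong_equiv}.
HB.instance Definition _ := Choice.on rpquot.

Definition rppi (a : realpoly C) : rpquot := \pi_{eq_quot rp_cong_equiv} a.

Definition rprepr (x : rpquot) : realpoly C := repr x.

Lemma rprepr_cong a : lspan tau (rprepr (rppi a) - a).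
Proof.
have /eqmodP : rprepr (rppi a) = a %[mod {eq_quot rp_cong_equiv}] by rewrite reprK.
by move=> /asboolP.
Qed.

Lemma rppi_eq a b : rppi a = rppi b <-> lspan tau (a - b).
Proof. by split=> [/eqmodP/asboolP|h] //; apply/eqmodP/asboolP. Qed.

Lemma rpreprK x : rppi (rprepr x) = x.
Proof. exact: reprK. Qed.

(* The positive cone of Q / R tau is the image of that of Q. *)
Definition rpquot_le (x y : rpquot) : bool :=
  `[< exists a b : realpoly C, [/\ rppi a = x, rppi b = y & a <=p b] >].

Lemma rpquot_leP x y : rpquot_le x y <->
  exists q v, [/\ pos C q, lspan tau v & rprepr y - rprepr x = q + v].
Proof.
split=> [/asboolP[a [b [<- <- /rp_leP ab]]]|[q [v [Cq sv e]]]].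
  exists (b - a), ((rprepr (rppi b) - b) - (rprepr (rppi a) - a)); split=> //.
    by apply: lspanD; [|apply: lspanN]; exact: rprepr_cong.
  by rv_ring.
apply/asboolP; exists (rprepr x), (rprepr x + q); split; first exact: rpreprK.
  rewrite -[RHS]rpreprK; apply/rppi_eq.
  have -> : rprepr y = rprepr x + q + v by rewrite -addrA -e addrC subrK.
  by rewrite opprD addrA subrr sub0r; exact: lspanN.
by apply/rp_leP; rewrite addrAC subrr add0r.
Qed.

Lemma rpquot_le_refl : reflexive rpquot_le.
Proof.
by move=> x; apply/asboolP; exists (rprepr x), (rprepr x); rewrite rpreprK.
Qed.

Lemma rpquot_le_anti : antisymmetric rpquot_le.
Proof.
move=> x y /andP[/rpquot_leP[q [v [Cq sv e]]] /rpquot_leP[q' [v' [Cq' sv' e']]]].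
rewrite -[x]rpreprK -[y]rpreprK; apply/rppi_eq.
have [u [w [su sw ew]]] := (lspanP _ _).1 (lspanN (lspanD sv sv')).
have eq : q + (q' + w) = u.
  have : (q + v) + (q' + v') = 0 by rewrite -e -e'; rv_ring.
  rewrite addrACA => /eqP; rewrite addr_eq0 ew => /eqP h.
  by rewrite addrA h subrK.
have sq : face_set tau q.
  by apply: (@face_addl _ _ _ _ _ (q' + w)); rewrite ?eq //; exact/posD/face_pos/sw.
by rewrite -opprB; apply: lspanN; rewrite e; apply: lspanD => //; exact: lspan_sub.
Qed.

Lemma rpquot_le_trans : transitive rpquot_le.
Proof.
move=> y x z /rpquot_leP[q [v [Cq sv e]]] /rpquot_leP[q' [v' [Cq' sv' e']]].
apply/rpquot_leP; exists (q' + q), (v' + v).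
by rewrite addrACA -e -e' subrKA; split=> //; [exact: posD|exact: lspanD].
Qed.

HB.instance Definition _ := Order.Le_isPOrder.Build (Order.Disp tt tt) rpquot
  rpquot_le_refl rpquot_le_anti rpquot_le_trans.

End QuotientGroup.

Section UpperBoundary.
Context (R : realType) (n : nat) (C : polycone R n).
Implicit Types s t : face C.

Definition minus_relint s (a : realpoly C) : set (realpoly C) :=
  [set b | exists2 u, relint s u & b = a - u].

Lemma minus_relint_neq0 s a : minus_relint s a !=set0.
Proof. by have [u su] := relint_neq0 s; exists (a - u), u. Qed.

Lemma minus_relint_ub s a i j : minus_relint s a i -> minus_relint s a j ->
  exists2 l, minus_relint s a l & i <=p l /\ j <=p l.
Proof.
move=> [u su ->] [v sv ->].
have [e /andP[e0 e1] h] := relint_absorb su (lspan_sub (face_relint_sub sv)).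
exists (a - e *: v); first by exists (e *: v) => //; exact: relintZ.
split; apply/rp_leP; rewrite opprB addrC addrA subrK; first exact: face_pos h.
rewrite -{1}[v]scale1r -scalerBl; apply: posZ; first by rewrite subr_ge0.
exact/face_pos/face_relint_sub/sv.
Qed.

Definition upper_dir s a : directed (realpoly C) :=
  Directed (minus_relint_neq0 s a) (@minus_relint_ub s a).

Lemma upper_dir_mono s t a b : a <=p b -> face_set t `<=` face_set s ->
  dominated (upper_dir s a) (upper_dir t b).
Proof.
move=> /rp_leP ab ts _ [u su ->].
have [v tv] := relint_neq0 t.
have [e /andP[e0 e1] h] := relint_absorb su (lspan_sub (ts _ (face_relint_sub tv))).
exists (b - e *: v); first by exists (e *: v) => //; exact: relintZ.
apply/rp_leP; have -> : b - e *: v - (a - u) = (b - a) + (u - e *: v).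
  by rv_ring.
by apply: posD => //; exact: face_pos h.
Qed.

Definition upper (k : fieldType) (M : pmod k (realpoly C)) s a : lmodType k :=
  dlim M (upper_dir s a).

Section Delta.
Context (tau : face C).

Definition delta_dir (p : realpoly C *p nabla tau) : directed (realpoly C) :=
  upper_dir p.2 p.1.

Lemma delta_dir_mono p q : p <=p q -> dominated (delta_dir p) (delta_dir q).
Proof.
case: p q => [a s] [b t]; rewrite leEprod /= => /andP[ab st].
by apply: upper_dir_mono => //; exact/asboolP/st.
Qed.

Definition delta (k : fieldType) (M : pmod k (realpoly C)) :
  pmod k (realpoly C *p nabla tau) := dlim_pmod delta_dir_mono M.

Definition delta_hom (k : fieldType) (M N : pmod k (realpoly C)) (phi : phom M N) :
  phom (delta M) (delta N) := dlim_phom delta_dir_mono phi.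

End Delta.

(* [below (upper_dir s a) b] says that b lies in a - relint s - Q_+. *)
Definition divides (k : fieldType) (M : pmod k (realpoly C)) b (y : M b)
    s a (x : upper M s a) :=
  exists h : below (upper_dir s a) b, dlim_in h y = x.

End UpperBoundary.

Section Socle.
Context (R : realType) (n : nat) (C : polycone R n) (tau : face C) (k : fieldType).

Local Notation Qn := (realpoly C *p nabla tau).
Local Notation Qqn := (rpquot tau *p nabla tau).

Definition ray (p : Qn) : set Qn := [set q | exists2 v, face_set tau v & q = (p.1 + v, p.2)].

Lemma ray_convex p a b c : a <=p b -> b <=p c -> ray p a -> ray p c -> ray p b.
Proof.
case: p a b c => [x s] [xa sa] [y t] [xc tc]; rewrite !leEprod /=.
move=> /andP[ab sb] /andP[bc tb] [v tv [ea es]] [w tw [ec et]]; subst xa sa xc tc.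
move/rp_leP: ab => ab; move/rp_leP: bc => bc.
exists (y - x); last first.
  by rewrite addrC subrK; congr pair; apply/le_anti; rewrite tb sb.
apply: (@face_addl _ _ _ _ _ ((x + w) - y)).
- have -> : y - x = (y - (x + v)) + v by rewrite opprD addrA subrK.
  by apply: posD => //; exact: face_pos tv.
- exact: bc.
- by rewrite addrC subrKA addrAC subrr add0r.
Qed.

Definition ray_cset (p : Qn) : convex_subset Qn := ConvexSubset (@ray_convex p).

Lemma ray_self p : ray_cset p p.
Proof. by case: p => a s; exists 0; rewrite ?addr0 //; exact: face0. Qed.

Lemma ray_ge p q : ray_cset p q -> p <=p q.
Proof.
case: p => a s [v tv ->]; rewrite leEprod /= lexx andbT.
by apply/rp_leP; rewrite addrAC subrr add0r; exact: face_pos tv.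
Qed.

Lemma ray_sub p q r : ray_cset p q -> ray_cset p r -> q <=p r -> ray_cset q r.
Proof.
case: p => a s [v tv ->] [w tw ->]; rewrite leEprod /= => /andP[/rp_leP h _].
have e : a + w - (a + v) = w - v by rewrite opprD addrACA subrr add0r.
rewrite e in h; exists (w - v); last by rewrite /= -addrA [v + _]addrC subrK.
by apply: (@face_addl _ _ _ _ _ v) => //; [exact: face_pos tv|rewrite subrK].
Qed.

Definition hom_tau (L : pmod k Qn) : psub L := hom_psub ray_self ray_ge ray_sub L.

Definition hom_tau_hom (L L' : pmod k Qn) (phi : phom L L') :
    phom (psub_pmod (hom_tau L)) (psub_pmod (hom_tau L')) :=
  psub_phom (@hom_psub_phom _ _ _ _ ray_self ray_ge ray_sub L L' phi).

Lemma ray_neq0 p : ray p !=set0.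
Proof. by exists p; exact: ray_self. Qed.

Lemma ray_ub p i j : ray p i -> ray p j -> exists2 l, ray p l & i <=p l /\ j <=p l.
Proof.
case: p => a s [v tv ->] [w tw ->] /=.
exists (a + (v + w), s); first by exists (v + w) => //; exact: faceD.
rewrite !leEprod /= !lexx !andbT; split; apply/rp_leP.
  have -> : a + (v + w) - (a + v) = w by rv_ring.
  exact: face_pos tw.
have -> : a + (v + w) - (a + w) = v by rv_ring.
exact: face_pos tv.
Qed.

Definition ray_dir (p : Qn) : directed Qn := Directed (ray_neq0 p) (@ray_ub p).

(* Each coset is represented by a chosen element; two choices give components that
   are identified by the action of R tau on the localization. *)
Definition quot_dir (p : Qqn) : directed Qn := ray_dir (rprepr p.1, p.2).

Lemma quot_dir_mono p q : p <=p q -> dominated (quot_dir p) (quot_dir q).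
Proof.
case: p q => [x s] [y t]; rewrite leEprod /= => /andP[/rpquot_leP xy st].
move=> _ [v tv ->] /=; case: xy => q [w [Cq /lspanP[u [u' [tu tu' ->]]] e]].
exists (rprepr y + (u' + v), t); first by exists (u' + v) => //; exact: faceD.
rewrite leEprod /= st andbT; apply/rp_leP.
have -> : rprepr y + (u' + v) - (rprepr x + v) = q + u.
  have -> : rprepr y + (u' + v) - (rprepr x + v) = (rprepr y - rprepr x) + u' by rv_ring.
  by rewrite e; rv_ring.
by apply: posD => //; exact: face_pos tu.
Qed.

Definition quot_restr (N : pmod k Qn) : pmod k Qqn := dlim_pmod quot_dir_mono N.

Definition quot_restr_hom (N N' : pmod k Qn) (phi : phom N N') :
  phom (quot_restr N) (quot_restr N') := dlim_phom quot_dir_mono phi.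

Lemma quot_below (p : Qn) : below (quot_dir (rppi tau p.1, p.2)) p.
Proof.
case: p => a s /=; have [u [v [tu tv e]]] := (lspanP _ _).1 (rprepr_cong tau a).
exists (rprepr (rppi tau a) + v, s); first by exists v.
rewrite leEprod /= lexx andbT; apply/rp_leP.
have -> : rprepr (rppi tau a) + v - a = u by rewrite addrAC e subrK.
exact: face_pos tu.
Qed.

(* Image of an element of N in N / tau. *)
Definition quot_in (N : pmod k Qn) (p : Qn) :
  N p -> quot_restr N (rppi tau p.1, p.2) := dlim_in (quot_below p).

Definition soc (M : pmod k (realpoly C)) : pmod k Qqn :=
  quot_restr (psub_pmod (hom_tau (delta tau M))).

Definition soc_hom (M N : pmod k (realpoly C)) (phi : phom M N) : phom (soc M) (soc N) :=
  quot_restr_hom (hom_tau_hom (delta_hom tau phi)).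

Definition cogenerator (M : pmod k (realpoly C)) (s : nabla tau) a
    (x : upper M s a) :=
  exists hx : psub_set (hom_tau (delta tau M)) (x : delta tau M (a, s)),
    quot_in (psub_mk hx) <> 0.

End Socle.

(* Main.v *)
Require Import Defs.
From mathcomp Require Import all_boot all_order all_algebra.
From mathcomp Require Import reals.
From mathcomp Require Import boolp classical_sets.
From mathcomp Require Import ring lra.

(** Injectivity passes to socles because every construction in [soc] is left exact:
    upper boundaries and quotient-restrictions are filtered direct limits, and in
    between one restricts to a submodule. Conversely, if [phi] kills a nonzero [z], it
    kills the image in [soc_tau M] of any cogenerator that [z] divides; so everything
    rests on the existence of such cogenerators ([exists_cogenerator_divided]).

    Let [y] be a nonzero element of [M] in degree [b]. It generates an interval
    module: all that matters is the set [D] of degrees above [b] in which [y]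
    survives, and [D] is closed downward above [b]. The task becomes to find faces [t]
    and [s] with [t] contained in [s], and a point [c], such that the part of [c + v -
    relint s] above [b] stays in [D] for all [v] in [t], leaves [D] for all other [v]
    in the cone, and the part of [c - relint s'] above [b] leaves [D] for the smaller
    faces [s'] that contain [t] ([exists_cogenerating_point]). This takes three
    extremal choices.

    - Moving up from [b] can only destroy directions in which [D] is unbounded. At a
      point [a] of [D] with as few such directions as possible, they are the same at
      all later points of [D]. A largest one, [v], spans a face [t], and then
      everything above [a] in [D] is invariant under [t], while [D] contains no ray
      from [a] outside [t] ([exists_stable_point]).
    - The points [c] such that the half-open segment from [a] to [c] is in [D] form a
      kind of closure of [D] above [a]. The supremum of this closure along any ray
      outside [t] is finite and attained, and going there makes that direction, and
      every direction that absorbs it, impossible from then on. Since only the support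
      of a direction matters, finitely many such moves lead to a point [c0] that is
      maximal modulo [t] ([exists_maximal_point]).
    - Put [c = c0 + v]. If [s] is the face having [c - a] in its interior, then [s]
      contains [t], and [c - relint s] reaches above [a] and is in [D] there. Among
      the faces over [t] with this property, take a smallest one. For [w] in the cone,
      if the image of [y] survives at [c + w] over [s], then [c + w] is in the closure
      above, so [w] is in [t] by maximality.

    Finiteness of the number of supports, a consequence of polyhedrality, replaces
    compactness and the finite generation of the cone. *)

Set Implicit Arguments.
Unset Strict Implicit.
Unset Printing Implicit Defensive.

Import Order.TTheory GRing.Theory Num.Theory.

Local Open Scope ring_scope.

Local Ltac rv_ring := apply/rowP => ?; rewrite !mxE; ring.
Local Ltac rv_field := apply/rowP => ?; rewrite !mxE; field.

Lemma exists_min_measure (T : Type) (P : T -> Prop) (f : T -> nat) :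
  (exists x, P x) -> exists2 x, P x & forall y, P y -> (f x <= f y)%N.
Proof.
case=> x; have [p] := ubnP (f x); elim: p x => // p IH x fx Px.
have [[y Py yx]|ny] := pselect (exists2 y, P y & (f y < f x)%N).
  by apply: (IH y) => //; exact: leq_trans yx _.
exists x => // y Py; rewrite leqNgt; apply/negP => yx; apply: ny; by exists y.
Qed.

(** * Absorption and faces of a polyhedral cone *)

Section Absorption.
Context (R : realType) (n : nat) (C : polycone R n).
Implicit Types u v w : 'rV[R]_n.

(** For [u] and [w] in the cone, this says that [w] lies in the smallest face that
    contains [u]. The formulation avoids both that face and its relative interior. *)
Definition absorbs u w := exists2 K : R, 0 < K & pos C (K *: u - w).

Lemma absorbs_refl u : absorbs u u.
Proof. by exists 1 => //; rewrite scale1r subrr; exact: pos0. Qed.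

Lemma absorbs_trans u v w : absorbs u v -> absorbs v w -> absorbs u w.
Proof.
move=> [K K0 h] [L L0 g]; exists (L * K); first exact: mulr_gt0.
have -> : (L * K) *: u - w = L *: (K *: u - v) + (L *: v - w) by rv_ring.
by apply: posD => //; apply: posZ => //; exact: ltW.
Qed.

Lemma absorbs_scale u w : absorbs u w -> exists2 e : R, 0 < e & pos C (u - e *: w).
Proof.
move=> [K K0 h]; exists K^-1; first by rewrite invr_gt0.
have -> : u - K^-1 *: w = K^-1 *: (K *: u - w).
  by rv_field; exact/lt0r_neq0.
by apply: posZ => //; rewrite invr_ge0 ltW.
Qed.

Lemma absorbs_addl u w : pos C u -> absorbs (u + w) w.
Proof. by move=> pu; exists 1 => //; rewrite scale1r addrK. Qed.

Lemma relint_absorbs (s : face C) u w : relint s u -> face_set s w -> absorbs u w.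
Proof.
move=> su sw; have [e /andP[e0 _] h] := relint_absorb su (lspan_sub sw).
exists e^-1; first by rewrite invr_gt0.
have -> : e^-1 *: u - w = e^-1 *: (u - e *: w).
  by rv_field; exact/lt0r_neq0.
by apply/posZ/(face_pos h); rewrite invr_ge0 ltW.
Qed.

Lemma face_absorbed (s : face C) u w : face_set s u -> pos C w -> absorbs u w ->
  face_set s w.
Proof.
move=> su pw [K K0 h]; apply: (face_addl pw h).
by rewrite addrC subrK; apply: faceZ => //; exact: ltW.
Qed.

(** A multiple of [u] dominates [w] for each half-space separately as soon as no
    half-space has [u] on its boundary but not [w]; there are finitely many half-spaces,
    so one multiple serves for all. *)
Lemma absorbsP m (A : 'M[R]_(n, m)) u w :
  pos C = (fun q => forall j, 0 <= (q *m A) 0 j) :> set 'rV[R]_n ->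
  pos C u -> pos C w ->
  absorbs u w <-> forall j, (u *m A) 0 j = 0 -> (w *m A) 0 j = 0.
Proof.
have coordE K j : ((K *: u - w) *m A) 0 j = K * (u *m A) 0 j - (w *m A) 0 j.
  by rewrite mulmxBl -scalemxAl; move: (u *m A) (w *m A) => x y; rewrite !mxE.
rewrite /absorbs => -> pu pw; split=> [[K K0 h] j uj|uw].
  apply/eqP; rewrite eq_le pw andbT -oppr_ge0.
  by have := h j; rewrite coordE uj mulr0 sub0r.
pose q j := (w *m A) 0 j / (u *m A) 0 j.
have q0 j : 0 <= q j by rewrite divr_ge0.
(* The summand 1 only ensures positivity; a quotient with zero denominator is 0. *)
exists (1 + \sum_j q j) => [|j]; first by rewrite ltr_pwDl // sumr_ge0.
rewrite coordE subr_ge0.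
have [uj|uj] := eqVneq ((u *m A) 0 j) 0; first by rewrite uj uw ?mulr0.
rewrite -{1}[_ 0 j](divfK uj) ler_wpM2r //.
by rewrite (bigD1 j) //= addrCA lerDl addr_ge0 // sumr_ge0.
Qed.

(** The support of a vector is the set of half-spaces whose boundary does not contain
    it. This is the only finiteness about the cone that the extremal choices below
    use: they minimize cardinals of supports or of sets of supports. *)
Lemma exists_support : exists m (supp : 'rV[R]_n -> {set 'I_m}),
  forall u w, pos C u -> pos C w -> absorbs u w <-> supp w \subset supp u.
Proof.
have [m [A eC]] := pos_halfspaces C.
exists m, (fun u => finset (fun j => (u *m A) 0 j != 0)) => u w pu pw.
apply: (iff_trans (absorbsP eC pu pw)); split=> [uw|/fintype.subsetP wu j uj].
  by apply/fintype.subsetP => j; rewrite !inE; apply: contraNN => /eqP/uw/eqP.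
by apply: contra_eq uj => wj; have := wu j; rewrite !inE; exact.
Qed.

Lemma exists_face_absorbed u : pos C u ->
  exists s : face C, forall w, face_set s w <-> pos C w /\ absorbs u w.
Proof.
move=> pu; have [m [A eC]] := pos_halfspaces C.
have posA w j : pos C w -> 0 <= (w *m A) 0 j by rewrite eC.
(* The sum of the normals of the half-spaces that have [u] on their boundary exposes
   the face. *)
pose l : 'cV[R]_n := \sum_(j | (u *m A) 0 j == 0) col j A.
have lE w : (w *m l) 0 0 = \sum_(j | (u *m A) 0 j == 0) (w *m A) 0 j.
  by rewrite mulmx_sumr summxE; apply: eq_bigr => j _; rewrite colE mulmxA -colE mxE.
have l0 w : pos C w -> 0 <= (w *m l) 0 0.
  by move=> pw; rewrite lE; apply: sumr_ge0 => j _; exact: posA.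
exists (Face (ex_intro2 _ _ l l0 erefl)) => w /=.
split=> -[pw]; rewrite (absorbsP eC pu pw) lE => wl; split=> //.
  move=> j /eqP uj; apply/eqP; move/eqP: wl; rewrite psumr_eq0 => [/allP wl|i _].
    by have := wl j (mem_index_enum _); rewrite uj.
  exact: posA.
by apply: big1 => j /eqP/wl.
Qed.

End Absorption.

(** * Maximal points of a bounded-below downset, modulo its directions of recession *)

Section MaximalPoint.
Context (R : realType) (n : nat) (C : polycone R n).
Context (D : set 'rV[R]_n) (b : 'rV[R]_n).
Context (D_b : D b).
Context (D_down : forall a a', pos C (a' - b) -> pos C (a - a') -> D a -> D a').
Implicit Types a c u v w : 'rV[R]_n.

Definition recedes a v := forall t : R, 0 <= t -> D (a + t *: v).

Lemma recedes_absorbed a v w :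
  pos C (a - b) -> pos C w -> absorbs C v w -> recedes a v -> recedes a w.
Proof.
move=> ab pw [K K0 h] av t t0; apply: (D_down _ _ (av (t * K) _)).
- have -> : a + t *: w - b = (a - b) + t *: w by rv_ring.
  exact/posD/posZ.
- have -> : a + (t * K) *: v - (a + t *: w) = t *: (K *: v - w) by rv_ring.
  exact: posZ.
- by rewrite mulr_ge0 // ltW.
Qed.

Lemma recedes_down a a' v : pos C (a' - b) -> pos C (a - a') -> pos C v ->
  recedes a v -> recedes a' v.
Proof.
move=> ab aa pv av t t0; apply: (D_down _ _ (av t t0)).
  have -> : a' + t *: v - b = (a' - b) + t *: v by rv_ring.
  exact/posD/posZ.
by have -> : a + t *: v - (a' + t *: v) = a - a' by rv_ring.
Qed.

(** Recession directions can only disappear along an ascent, so a point where they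
    have as few supports as possible keeps all of them from there on. Stability also
    makes them closed under addition, which is why one of maximal support absorbs all
    the others. *)
Lemma exists_stable_point : exists a v, [/\ pos C (a - b), D a, pos C v,
  forall a', pos C (a' - a) -> D a' -> recedes a' v &
  forall w, pos C w -> recedes a w -> absorbs C v w].
Proof.
have [m [supp suppP]] := exists_support C.
pose U a := finset (fun I => `[< exists v, [/\ pos C v, recedes a v & supp v = I] >]).
have U_down a a' : pos C (a' - b) -> pos C (a - a') -> U a \subset U a'.
  move=> ab aa; apply/fintype.subsetP => I; rewrite !finset.in_set.
  move=> /asboolP[v [pv av e]]; apply/asboolP; exists v; split=> //.
  exact: recedes_down aa pv av.
have bb : pos C (b - b) by rewrite subrr; exact: pos0.
have [a [ab Da] amin] := exists_min_measure
  (P := fun a => pos C (a - b) /\ D a) (fun a => #|U a|)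
  (ex_intro _ b (conj bb D_b)).
(* The zero direction always recedes, so a maximal one exists. *)
have r0 : pos C 0 /\ recedes a 0.
  by split=> [|t _]; [exact: pos0|rewrite scaler0 addr0].
have [v [pv av] vmax] := exists_min_measure
  (P := fun v => pos C v /\ recedes a v) (fun v => #|~: supp v|) (ex_intro _ _ r0).
have stable a' : pos C (a' - a) -> D a' -> recedes a' v.
  move=> aa Da'; have a'b : pos C (a' - b) by rewrite -(subrKA a); exact: posD.
  have UU : U a' = U a by apply/eqP; rewrite eqEcard U_down //= amin.
  have : supp v \in U a' by rewrite UU finset.in_set; apply/asboolP; exists v.
  rewrite finset.in_set => /asboolP[w [pw a'w e]].
  by apply: recedes_absorbed a'w => //; apply/suppP => //; rewrite e.
exists a, v; split=> // w pw aw.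
have pvw := posD pv pw.
have avw : recedes a (v + w).
  move=> t t0; have -> : a + t *: (v + w) = (a + t *: w) + t *: v by rv_ring.
  apply: stable => //; last exact: aw.
  by rewrite addrAC subrr add0r; exact: posZ.
have sub : supp v \subset supp (v + w).
  by apply/suppP => //; rewrite addrC; exact: absorbs_addl.
have e : supp v = supp (v + w).
  apply/eqP; rewrite eqEcard sub /=.
  have := vmax _ (conj pvw avw); rewrite -(leq_add2l #|supp v|) cardsC.
  by rewrite -(cardsC (supp (v + w))) leq_add2r.
by apply/suppP => //; rewrite e; apply/suppP => //; exact: absorbs_addl.
Qed.

(** This set contains the limits of increasing sequences of [D] above [b], and
    membership of [c] is tested by approaching [c] only from below, along the segment
    from [b]. In contrast to the topological closure, it thus remembers with which
    face, that of [c - b], the point [c] can be approached within [D]. *)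
Definition radial_closure c :=
  pos C (c - b) /\ forall t : R, 0 <= t < 1 -> D (b + t *: (c - b)).

Local Notation E := radial_closure.

Lemma radial_closure_base : E b.
Proof. by rewrite /E subrr; split=> [|t _]; [exact: pos0|rewrite scaler0 addr0]. Qed.

Lemma radial_closure_down c c' : pos C (c' - b) -> pos C (c - c') -> E c -> E c'.
Proof.
move=> cb cc [_ h]; split=> // t /andP[t0 t1].
apply: (D_down _ _ (h t _)); last by rewrite t0.
  by rewrite addrAC subrr add0r; exact: posZ.
have -> : b + t *: (c - b) - (b + t *: (c' - b)) = t *: (c - c') by rv_ring.
exact: posZ.
Qed.

(** One ascends along [w] to the supremum of the closure on that ray. The supremum is
    finite, for otherwise the halfway points already put the ray from [b] in the
    direction [w] into [D]. It is attained, because a point of the segment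
    from [b] to the limit is dominated by a point slightly farther out on the segment
    from [b] to a point close to the limit. *)
Lemma radial_closure_step c w : pos C w -> ~ recedes b w -> E c ->
  exists2 c', pos C (c' - c) /\ E c' & forall t : R, 0 < t -> ~ E (c' + t *: w).
Proof.
move=> pw nw Ec; have [cb _] := Ec.
pose S := (fun s : R => 0 <= s /\ E (c + s *: w)) : set R.
have S0 : S 0 by rewrite /S /= scale0r addr0.
have hS : has_sup S.
  split; first by exists 0.
  apply: contrapT => nb; apply: nw => r r0.
  have [s [s0 [_ Es]] rs] : exists2 s, S s & 2 * r < s.
    apply: contrapT => ns; apply: nb; exists (2 * r) => s Ss.
    by rewrite leNgt; apply/negP => rs; apply: ns; exists s.
  apply: (D_down _ _ (Es 2^-1 _)); last by apply/andP; split; lra.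
    by rewrite addrAC subrr add0r; exact: posZ.
  have -> : b + 2^-1 *: (c + s *: w - b) - (b + r *: w) =
      2^-1 *: (c - b) + (2^-1 * s - r) *: w by rv_ring.
  by apply: posD; apply: posZ => //; lra.
pose z := sup S.
have Sz s : S s -> s <= z by move=> Ss; apply: ub_le_sup => //; case: hS.
have z0 := Sz _ S0.
have czb : pos C (c + z *: w - b).
  have -> : c + z *: w - b = (c - b) + z *: w by rv_ring.
  exact/posD/posZ.
have Ez : E (c + z *: w).
  split=> // t /andP[t0 t1].
  (* The factor [(1 + t) / 2] lies strictly between [t] and 1. *)
  have [s Ss zs] : exists2 s, S s & t * z <= (1 + t) / 2 * s.
    have [->|zn0] := eqVneq z 0; first by exists 0 => //; rewrite !mulr0.
    have zgt0 : 0 < z by rewrite lt_neqAle eq_sym zn0.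
    have h0 : 0 < (1 + t) / 2 by lra.
    have tz : t * z / ((1 + t) / 2) < z.
      by rewrite ltr_pdivrMr // mulrC ltr_pM2l //; lra.
    have [s Ss ts] := sup_gt (ex_intro _ 0 S0) tz.
    by exists s => //; rewrite [leRHS]mulrC -ler_pdivrMr // ltW.
  case: Ss => s0 [_ Es]; apply: (D_down _ _ (Es ((1 + t) / 2) _)).
  - by rewrite addrAC subrr add0r; exact: posZ.
  - have -> : b + ((1 + t) / 2) *: (c + s *: w - b) - (b + t *: (c + z *: w - b)) =
        ((1 + t) / 2 - t) *: (c - b) + ((1 + t) / 2 * s - t * z) *: w by rv_ring.
    by apply: posD; apply: posZ; rewrite ?subr_ge0 //; lra.
  - by apply/andP; split; lra.
exists (c + z *: w); first by split=> //; rewrite addrAC subrr add0r; exact: posZ.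
move=> t t0 Et; have : z + t <= z; last by lra.
by apply: Sz; split; [lra|rewrite scalerDl addrA].
Qed.

(** Each ascent removes the support of its direction from the set [W] of supports of
    directions, not absorbed by [v], in which the closure can be followed, and [W]
    never grows along an ascent; so [W] is empty where its cardinal is least. *)
Lemma exists_maximal_point v : (forall w, pos C w -> recedes b w -> absorbs C v w) ->
  exists2 c, E c & forall w, pos C w -> E (c + w) -> absorbs C v w.
Proof.
move=> vmax; have [m [supp suppP]] := exists_support C.
pose W c := finset (fun I => `[< exists w, [/\ pos C w, ~ absorbs C v w, supp w = I &
  exists2 t : R, 0 < t & E (c + t *: w)] >]).
have [c Ec cmin] := exists_min_measure (fun c => #|W c|)
  (ex_intro _ _ radial_closure_base).
exists c => // w pw Ew; apply: contrapT => nvw.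
have [|c' [cc Ec'] max] := radial_closure_step pw _ Ec.
  by move/(vmax w pw).
have := cmin _ Ec'; rewrite leqNgt => /negP; apply; apply: proper_card.
apply/fintype.properP; split.
  apply/fintype.subsetP => I; rewrite !finset.in_set => /asboolP[x [px nvx e [t t0 Et]]].
  apply/asboolP; exists x; split=> //; exists t => //.
  apply: radial_closure_down Et.
    have -> : c + t *: x - b = (c - b) + t *: x by rv_ring.
    by apply/posD/posZ => //; [exact: Ec.1|exact: ltW].
  by have -> : c' + t *: x - (c + t *: x) = c' - c by rv_ring.
exists (supp w); rewrite finset.in_set.
  by apply/asboolP; exists w; split=> //; exists 1 => //; rewrite scale1r.
apply/asboolP => -[x [px _ e [t t0 Et]]].
have [r r0 h] : exists2 r : R, 0 < r & pos C (x - r *: w).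
  by apply/absorbs_scale/suppP => //; rewrite e.
(* A direction with the same support as [w] dominates a multiple of [w], but the
   closure ends at [c'] in the direction [w]. *)
apply: (max (t * r)); first exact: mulr_gt0.
apply: radial_closure_down Et.
  have -> : c' + (t * r) *: w - b = (c' - b) + (t * r) *: w by rv_ring.
  apply/posD/posZ => //; first exact: Ec'.1.
  exact/ltW/mulr_gt0.
have -> : c' + t *: x - (c' + (t * r) *: w) = t *: (x - r *: w) by rv_ring.
exact/posZ/h/ltW.
Qed.

End MaximalPoint.

(** * Cogenerators of a downset *)

Section CogeneratingPoint.
Context (R : realType) (n : nat) (C : polycone R n).
Context (D : set 'rV[R]_n) (b : 'rV[R]_n).
Context (D_b : D b).
Context (D_down : forall a a', pos C (a' - b) -> pos C (a - a') -> D a -> D a').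
Implicit Types a c u v w : 'rV[R]_n.

(** If [D] is the set of degrees in which an element [y] of degree [b] survives, and
    [b] is below [c - relint s], then these are the degrees [c] in which the image of
    [y] in the upper boundary along [s] is nonzero. *)
Definition in_upper_boundary (s : face C) c :=
  forall u, relint s u -> pos C (c - u - b) -> D (c - u).

(** The last four conditions on [t], [s] and [c] say in turn that an element with
    survival set [D] has an image in degree [(c, s)] of the upper boundary, that this
    image survives along [t], that it dies on leaving [t], and that it dies on passing
    to a smaller face over [t]. *)
Lemma exists_cogenerating_point : exists (t s : face C) c,
  [/\ face_set t `<=` face_set s,
      exists2 u, relint s u & pos C (c - u - b),
      forall v, face_set t v -> in_upper_boundary s (c + v),
      forall v, pos C v -> ~ face_set t v -> ~ in_upper_boundary s (c + v) &
      forall s' : face C, face_set t `<=` face_set s' -> face_set s' `<=` face_set s ->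
        s' <> s -> ~ in_upper_boundary s' c]%classic.
Proof.
have [a [v [ab Da pv stable vmax]]] := exists_stable_point D_b D_down.
have from_a c : pos C (c - a) -> pos C (c - b).
  by move=> ca; rewrite -(subrKA a); exact: posD.
have Da_down c c' : pos C (c' - a) -> pos C (c - c') -> D c -> D c'.
  by move=> ca; apply: D_down; exact: from_a.
have [c0 Ec0 c0max] := exists_maximal_point Da Da_down vmax.
have [t tE] := exists_face_absorbed pv.
(* Adding [v] makes [c - a] absorb [v], so that the face of [c - a] contains [t]. *)
pose c := c0 + v.
have ca : pos C (c - a).
  have -> : c - a = (c0 - a) + v by rewrite /c; rv_ring.
  by apply: posD => //; exact: Ec0.1.
have Ec : radial_closure C D a c.
  split=> // r /andP[r0 r1].
  have -> : a + r *: (c - a) = (a + r *: (c0 - a)) + r *: v by rewrite /c; rv_ring.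
  apply: stable => //; last by apply: Ec0.2; rewrite r0.
  by rewrite addrAC subrr add0r; apply: posZ => //; exact: Ec0.1.
have cmax w : pos C w -> radial_closure C D a (c + w) -> face_set t w.
  move=> pw Ew; apply/tE; split=> //; apply: c0max => //.
  apply: radial_closure_down Ew => //.
    have -> : c0 + w - a = (c0 - a) + w by rv_ring.
    by apply: posD => //; exact: Ec0.1.
  by have -> : c + w - (c0 + w) = v by rewrite /c; rv_ring.
(* [good u] says that, for the smallest face [s] containing [u], [t] is contained in
   [s], and [c - relint s] reaches above [a] and is in [D] there. *)
pose good u := [/\ pos C u, absorbs C u v,
  exists2 r : R, 0 < r & pos C (c - r *: u - a) &
  forall r : R, 0 < r -> pos C (c - r *: u - a) -> D (c - r *: u)].
have good_ca : good (c - a).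
  split=> //.
  - have -> : c - a = (c0 - a) + v by rewrite /c; rv_ring.
    by apply: absorbs_addl; exact: Ec0.1.
  - by exists 1; rewrite // scale1r subKr subrr; exact: pos0.
  move=> r r0 cra; have [r1|r1] := leP r 1.
    have -> : c - r *: (c - a) = a + (1 - r) *: (c - a) by rv_ring.
    by apply: Ec.2; apply/andP; split; lra.
  (* Beyond [r = 1] the point has passed below [a]. *)
  apply: (Da_down a) => //.
  have -> : a - (c - r *: (c - a)) = (r - 1) *: (c - a) by rv_ring.
  by apply: posZ => //; lra.
have [m [supp suppP]] := exists_support C.
have [u [pu uv [r0 r0_gt0 cu] uD] umin] :=
  exists_min_measure (fun u => #|supp u|) (ex_intro _ _ good_ca).
have [s sE] := exists_face_absorbed pu.
have su : face_set s u by apply/sE; split=> //; exact: absorbs_refl.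
have ts : (face_set t `<=` face_set s)%classic.
  by move=> w /tE[pw vw]; apply/sE; split=> //; exact: absorbs_trans uv vw.
exists t, s, c; split=> //.
- have [w sw] := relint_neq0 s.
  have [_ uw] := (sE w).1 (face_relint_sub sw).
  have [e e0 he] := absorbs_scale uw.
  exists ((r0 * e) *: w); first by apply: relintZ => //; exact: mulr_gt0.
  apply: from_a.
  have -> : c - (r0 * e) *: w - a = (c - r0 *: u - a) + r0 *: (u - e *: w) by rv_ring.
  by apply/posD/posZ => //; exact: ltW.
- move=> x /tE[px vx] w sw cxw.
  have [e e0 he] := absorbs_scale (relint_absorbs sw su).
  pose q := Num.min r0 e.
  have q0 : 0 < q by rewrite lt_min r0_gt0.
  have [qr qe] : q <= r0 /\ q <= e by rewrite !ge_min !lexx orbT.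
  have cqa : pos C (c - q *: u - a).
    have -> : c - q *: u - a = (c - r0 *: u - a) + (r0 - q) *: u by rv_ring.
    by apply/posD/posZ => //; rewrite subr_ge0.
  have qx : recedes D (c - q *: u) x.
    apply: (recedes_absorbed Da_down cqa px vx).
    by apply: stable => //; exact: uD.
  apply: (D_down cxw _ (qx 1 ler01)).
  have -> : c - q *: u + 1 *: x - (c + x - w) = (w - e *: u) + (e - q) *: u by rv_ring.
  by apply/posD/posZ => //; rewrite subr_ge0.
(* If the image survived at [c + x], then [c + x] would be in the closure. *)
- move=> x px ntx xD; apply: ntx; apply: cmax => //.
  have cxa : pos C (c + x - a).
    have -> : c + x - a = (c - a) + x by rv_ring.
    exact: posD.
  split=> // r /andP[r_ge0 r_lt1].
  have [w sw] := relint_neq0 s.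
  have [_ uw] := (sE w).1 (face_relint_sub sw).
  have [e e0 he] := absorbs_scale uw.
  pose q := (1 - r) * r0 * e.
  have q0 : 0 < q by rewrite !mulr_gt0 // subr_gt0.
  have qle : pos C (c + x - q *: w - (a + r *: (c + x - a))).
    have -> : c + x - q *: w - (a + r *: (c + x - a)) =
        (1 - r) *: ((c - r0 *: u - a) + r0 *: (u - e *: w) + x) by rewrite /q; rv_ring.
    apply: posZ; first by lra.
    by apply: posD => //; apply/posD/posZ => //; exact: ltW.
  have pr : pos C (a + r *: (c + x - a) - a).
    by rewrite addrAC subrr add0r; exact: posZ.
  apply: (Da_down _ _ pr qle); apply: xD; first exact: relintZ.
  apply: from_a.
  by rewrite -(subrKA (a + r *: (c + x - a))); exact: posD.
(* A direction in the interior of [s'] would be good with smaller support. *)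
move=> s' ts' s's ne s'D; apply: ne.
have [w sw] := relint_neq0 s'.
have s'w := face_relint_sub sw.
have pw := face_pos s'w.
have [_ uw] := (sE w).1 (s's _ s'w).
have [e e0 he] := absorbs_scale uw.
have good_w : good w.
  split=> //.
  - by apply: (relint_absorbs sw); apply/ts'/tE; split=> //; exact: absorbs_refl.
  - exists (r0 * e); first exact: mulr_gt0.
    have -> : c - (r0 * e) *: w - a = (c - r0 *: u - a) + r0 *: (u - e *: w) by rv_ring.
    by apply/posD/posZ => //; exact: ltW.
  - move=> r r_gt0 cra; apply: s'D; first exact: relintZ.
    exact: from_a.
have wu : absorbs C w u.
  apply/suppP => //; suff -> : supp w = supp u by [].
  by apply/eqP; rewrite eqEcard umin // andbT; exact/suppP.
apply/face_inj/seteqP; split=> // x /sE[px ux].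
apply: (face_absorbed s'w) => //; exact: absorbs_trans wu ux.
Qed.

End CogeneratingPoint.

(** * Direct limits and injectivity *)

Section DirectLimits.
Context (k : fieldType) (d : Order.disp_t) (P : porderType d).

Lemma dlim_in_eq0 (M : pmod k P) (D : directed P) b (h : below D b) (x : M b) :
  dlim_in h x = 0 <->
  exists2 l, D l & exists bl : (b <= l)%O, pstr M bl x = 0.
Proof.
have [i Di bi] := h; rewrite (dlim_inE h Di bi).
split=> [e|[l Dl [bl e]]].
  have : dlim_pi Di (pstr M bi x) = dlim_pi Di 0 by rewrite e linear0.
  move=> /dlim_pi_eq[l Dl [il [il']]].
  rewrite linear0 (pstr_comp _ _ (le_trans bi il)) => el.
  by exists l => //; exists (le_trans bi il).
have [j Dj [ij lj]] := dset_ub Di Dl.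
rewrite -(dlim_pi_str Di Dj ij) (pstr_comp _ _ (le_trans bl lj)).
by rewrite -(pstr_comp bl lj) e linear0 linear0.
Qed.

Lemma dlim_phom_inj (d' : Order.disp_t) (P' : porderType d') (F : P' -> directed P)
    (Fmono : forall a b, (a <= b)%O -> dominated (F a) (F b))
    (M N : pmod k P) (phi : phom M N) :
  pinjective phi -> pinjective (dlim_phom Fmono phi).
Proof.
move=> phi_inj a x y; have [i [Di [m [n [-> ->]]]]] := dlim_pi2P x y.
move=> e.
have : dlim_fun phi (F a) (dlim_pi Di m) = dlim_fun phi (F a) (dlim_pi Di n) := e.
rewrite !dlim_fun_pi => /dlim_pi_eq[l Dl [h1 [h2]]].
rewrite -!Defs.pnat => /phi_inj emn; apply/dlim_pi_eq.
by exists l => //; exists h1, h2.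
Qed.

Lemma psub_phom_inj (M N : pmod k P) (phi : phom M N) (S : psub M) (T : psub N)
    (ST : forall a (x : M a), psub_set S x -> psub_set T (phi a x)) :
  pinjective phi -> pinjective (psub_phom ST).
Proof.
move=> phi_inj a x y /(congr1 (@psub_val _ _ _ _ _ _)) /= /phi_inj e.
exact: val_inj.
Qed.

End DirectLimits.

(** * Socles and cogenerators *)

Section Socles.
Context (R : realType) (n : nat) (C : polycone R n) (k : fieldType).

Lemma soc_hom_inj (M N : pmod k (realpoly C)) (phi : phom M N) (tau : face C) :
  pinjective phi -> pinjective (soc_hom tau phi).
Proof. by move=> h; apply/dlim_phom_inj/psub_phom_inj/dlim_phom_inj. Qed.

(** The structure maps of [M] and of its upper boundaries are compatible, so
    whether the image of [y] vanishes in any degree is read off from the survival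
    set [D]; [exists_cogenerating_point] applied to [D] then gives the degree. *)
Lemma exists_cogenerator_divided (M : pmod k (realpoly C)) (b : realpoly C) (y : M b) :
  y <> 0 -> exists (tau : face C) (sigma : nabla tau) (a : realpoly C)
    (x : upper M sigma a), cogenerator x /\ divides y x.
Proof.
move=> y0.
pose D : set 'rV[R]_n := fun a => exists ba : (b <= (a : realpoly C))%O, pstr M ba y <> 0.
have Db : D b by exists (lexx b); rewrite pstr_id.
have D_down a a' : pos C (a' - b) -> pos C (a - a') -> D a -> D a'.
  move=> /rp_leP ba' /rp_leP aa' [ba ya]; exists ba' => ya'; apply: ya.
  by rewrite -(pstr_comp ba' aa' ba) ya' linear0.
have [tau [s [c [ts [u su cub] s_in s_out s'_out]]]] :=
  exists_cogenerating_point Db D_down.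
pose sigma : nabla tau := Nabla (asboolT ts).
have image_neq0 s' a (h : below (upper_dir s' a) b) :
    dlim_in h y <> 0 <-> in_upper_boundary D b s' a.
  rewrite dlim_in_eq0; split=> [ne w sw /rp_leP baw|aD [l [w sw ->] [bl e]]].
    by exists baw => e; apply: ne; exists (a - w); [exists w|exists baw].
  have /rp_leP cwb := bl.
  by have [bl' []] := aD w sw cwb; rewrite (Prop_irrelevance bl' bl).
have hc : below (upper_dir s c) b by exists (c - u); [exists u|exact/rp_leP].
exists tau, sigma, c, (dlim_in hc y); split; last by exists hc.
have push a (s' : nabla tau)
    (pq : @Order.le _ (realpoly C *p nabla tau) (c, sigma) (a, s'))
    (h : below (upper_dir s' a) b) :
    pstr (delta tau M) pq (dlim_in hc y) = dlim_in h y.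
  exact: (dlim_map_in (delta_dir_mono pq) hc h y).
(* A degree above [(c, s)] outside its translate of [tau] either has a smaller face,
   and then the image already dies over [c], or is of the form [(c + w, s)] with [w]
   outside [tau]. *)
have x_soc : psub_set (hom_tau (delta tau M)) (dlim_in hc y : delta tau M (c, sigma)).
  apply/(hom_imgP (@ray_self _ _ _ tau) (@ray_ge _ _ _ tau)) => -[a s'] pq nray.
  have h : below (upper_dir s' a) b := below_trans (delta_dir_mono pq) hc.
  rewrite (push _ _ pq h); apply: contrapT => /image_neq0 aD.
  have /andP[/rp_leP ca /asboolP s's] : ((c : realpoly C) <= a)%O && (sigma <= s')%O.
    by move: pq; rewrite leEprod.
  have /asboolP ts' := nablaP s'.
  have [e|ne] := pselect (nabla_face s' = s).
    apply: (s_out (a - c)) => //; last by rewrite addrC subrK -e.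
    move=> tac; apply: nray; exists (a - c) => //=.
    by rewrite addrC subrK; congr pair; exact: val_inj.
  apply: (s'_out s') => // w sw cwb.
  have acw : pos C (a - w - (c - w)).
    by have -> : a - w - (c - w) = a - c by rewrite opprB addrA subrK.
  apply: (D_down (a - w)) => //; apply: aD => //.
  by rewrite -(subrKA (c - w)); exact: posD.
(* Vanishing in the quotient-restriction means vanishing at some [a] in the coset of
   [c]; such an [a] above [c] is in [c + tau]. *)
exists x_soc; rewrite /quot_in => /dlim_in_eq0[_ [v tv ->] [pq]].
set a := rprepr _ + v in pq *.
have h : below (upper_dir s a) b := below_trans (delta_dir_mono pq) hc.
rewrite [LHS](push _ _ pq h); apply/image_neq0.
have -> : a = c + (a - c) :> 'rV[R]_n by rewrite addrC subrK.
apply: s_in.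
have /rp_leP ca : ((c : realpoly C) <= a)%O by move: pq; rewrite leEprod => /andP[].
have : lspan tau (a - c).
  rewrite /a addrAC; apply: lspanD (lspan_sub tv); exact: rprepr_cong.
move=> /lspanP[x [z [tx tz e]]]; apply: (face_addl ca (face_pos tz)).
by rewrite e subrK.
Qed.

End Socles.

Theorem theorem7p7 (R : realType) (n : nat) (C : polycone R n) (k : fieldType)
    (M N : pmod k (realpoly C)) (phi : phom M N) :
  [/\ pinjective phi -> forall tau : face C, pinjective (soc_hom tau phi),
      (forall tau : face C, pinjective (soc_hom tau phi)) ->
        downset_finite M -> pinjective phi
    & downset_finite M ->
        forall (b : realpoly C) (y : M b), y <> 0 ->
        exists (tau : face C) (sigma : nabla tau) (a : realpoly C)
               (x : upper M sigma a), cogenerator x /\ divides y x].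
Proof.
split=> [phi_inj tau|soc_inj _ b y y' e|_ b y]; first exact: soc_hom_inj.
  apply: contrapT => ne; have yy0 : y - y' <> 0 by move/eqP; rewrite subr_eq0 => /eqP.
  have [tau [sigma [a [x [[x_soc x0] [hb ex]]]]]] := exists_cogenerator_divided yy0.
  (* The image of [x] in the quotient-restriction of the whole upper boundary vanishes
     once its image in the socle does. *)
  apply: x0; apply/dlim_in_eq0.
  suff /dlim_in_eq0[l lD [xl e0]] : dlim_in (M := psub_pmod (hom_tau (delta tau M)))
      (quot_below (a, sigma : nabla tau)) (psub_mk x_soc) = 0.
    by exists l => //; exists xl; exact: (congr1 (@psub_val _ _ _ _ _ _) e0).
  apply: soc_inj; rewrite linear0.
  rewrite [LHS](dlim_fun_in _ (quot_below (a, sigma : nabla tau))).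
  have -> : hom_tau_hom (delta_hom tau phi) (a, sigma) (psub_mk x_soc) = 0.
    apply: val_inj => /=; rewrite -ex [LHS](dlim_fun_in phi hb).
    by rewrite linearB e subrr linear0.
  by rewrite linear0.
exact: exists_cogenerator_divided.
Qed.
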